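(* The functional $\mathcal{Q}:\mathcal{L}\to\mathbb{R}$ is concave, i.e. for all $(K_1,B_1,D_1),(K_2,B_2,D_2)\in\mathcal{L}$ and $\lambda\in[0,1]$, $$\mathcal{Q}\bigl(c_\lambda((K_1,B_1,D_1),(K_2,B_2,D_2))\bigr)\ge(1-\lambda)\mathcal{Q}(K_1,B_1,D_1)+\lambda\,\mathcal{Q}(K_2,B_2,D_2).$$
   Context: $|X|$ is area. $u_t=(\cos t,\sin t)$, $v_t=(-\sin t,\cos t)$, $S^1=\mathbb{R}/2\pi\mathbb{Z}$. For a convex body $K$ (nonempty compact convex subset of $\mathbb{R}^2$): $h_K(t)=\sup_{p\in K}p\cdot u_t$; the edge is $e_K(t)=\{p\in K:p\cdot u_t=h_K(t)\}$; $v_K^+(t)$ (resp. $v_K^-(t)$) is the endpoint of $e_K(t)$ farthest in direction $v_t$ (resp. $-v_t$); $\sigma_K$ is the surface area measure on $S^1$. The constant $\varphi$: $(p,q,\varphi,\theta)$ is the solution with $0<\varphi<\theta<\pi/4$ (numerically $p\approx 0.0944265608$, $q\approx 1.3992037273$, $\varphi\approx 0.0391773648$, $\theta\approx 0.6813015094$) of $p(\cos\theta-\cos\varphi)-2q\sin\varphi+(\theta-\varphi-1)\cos\theta-\sin\theta+\cos\varphi+\sin\varphi=0$, $p(3\sin\theta+\sin\varphi)-2q\cos\varphi+3(\theta-\varphi-1)\sin\theta+3\cos\theta-\sin\varphi+\cos\varphi=0$, $p\cos\varphi=\sin\varphi+\frac12-\frac12\cos\varphi+q\sin\varphi$, $p+\frac{\pi}{2}-\varphi-\theta=q-\frac12(\theta-\varphi)(1+p)-\frac14(\theta-\varphi)^2$.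 Put $\varphi^{\mathrm R}=\varphi$, $\varphi^{\mathrm L}=\pi/2-\varphi$. Caps. A cap (rotation angle $\pi/2$) is a convex body $K$ with $h_K(\pi/2)=1$, $h_K(3\pi/2)=0$, which is an intersection of closed half-planes $\{p\cdot u_t\le c\}$ with $t\in[0,\pi]\cup\{3\pi/2\}$. Let $\mathbf{x}_K(t)=(h_K(t)-1)u_t+(h_K(t+\pi/2)-1)v_t$. $\mathcal{K}^{\mathrm i}$ is the set of caps $K$ with $|K|\ge2.2$ satisfying the injectivity condition: (1) $\sigma_K$ restricted to $[0,\pi/2)$ and to $(\pi/2,\pi]$ is absolutely continuous with respect to Lebesgue measure (has nonnegative measurable densities); (2) $\mathbf{x}_K:[0,\pi/2]\to\mathbb{R}^2$ is continuously differentiable; (3) $\mathbf{x}_K'(t)\cdot u_t<0$ and $\mathbf{x}_K'(t)\cdot v_t>0$ for all $t\in(0,\pi/2)$. $\mathcal{L}$ is the set of all triples $(K,B,D)$ of convex bodies such that: $K\in\mathcal{K}^{\mathrm i}$, $B\subseteq K$, $D\subseteq K$; $h_K(t)+h_B(\pi+t)\le1$ for every $t\in[\varphi^{\mathrm R},\pi/2]$, with equality at $t=\varphi^{\mathrm R}$ and $t=\pi/2$; $h_K(\pi/2+t)+h_D(3\pi/2+t)\le1$ for every $t\in[0,\varphi^{\mathrm L}]$, with equality at $t=0$ and $t=\varphi^{\mathrm L}$. For convex bodies $c_\lambda(K_1,K_2)=(1-\lambda)K_1+\lambda K_2$ (Minkowski combination), and on triples $c_\lambda$ acts componentwise; $\mathcal{L}$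 is closed under $c_\lambda$. Curve area. For a continuous $\mathbf{z}=(x,y):[a,b]\to\mathbb{R}^2$ of bounded variation, $\mathcal{J}(\mathbf{z})=\frac12\int_a^b x\,dy-y\,dx$ (Stieltjes integrals); it depends only on the oriented curve. For points $p=(p_1,p_2)$, $q=(q_1,q_2)$, $\mathcal{J}(p,q)=\frac12(p_1q_2-p_2q_1)$. For a convex body $X$ and $a<b<a+\pi$, $\mathbf{u}_X^{a,b}=\{v_X^+(a)\}\cup\bigcup_{t\in(a,b)}e_X(t)\cup\{v_X^-(b)\}$, an oriented rectifiable arc (possibly a point) of $\partial X$ from $v_X^+(a)$ to $v_X^-(b)$. The functional. For $(K,B,D)\in\mathcal{L}$, $$\mathcal{Q}(K,B,D)=|K|+\mathcal{J}(\mathbf{d}_D)+\mathcal{J}(Y_D,\mathbf{x}_K^{\mathrm L})-\mathcal{J}\bigl(\mathbf{x}_K|_{[\varphi^{\mathrm R},\varphi^{\mathrm L}]}\bigr)+\mathcal{J}(\mathbf{x}_K^{\mathrm R},X_B)+\mathcal{J}(\mathbf{b}_B),$$ where $\mathbf{b}_B=\mathbf{u}_B^{\pi+\varphi^{\mathrm R},3\pi/2}$, $X_B=v_B^+(\pi+\varphi^{\mathrm R})$, $\mathbf{d}_D=\mathbf{u}_D^{3\pi/2,3\pi/2+\varphi^{\mathrm L}}$, $Y_D=v_D^-(3\pi/2+\varphi^{\mathrm L})$, $\mathbf{x}_K^{\mathrm R}=\mathbf{x}_K(\varphi^{\mathrm R})$, $\mathbf{x}_K^{\mathrm L}=\mathbf{x}_K(\varphi^{\mathrm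 L})$. *)

(* Defs.v *)
From HB Require Import structures.
From mathcomp Require Import all_boot all_order all_algebra.
From mathcomp Require Import all_classical all_reals all_analysis.

Set Implicit Arguments.
Unset Strict Implicit.
Unset Printing Implicit Defensive.

Import Order.TTheory GRing.Theory Num.Theory.
Import numFieldNormedType.Exports.

Local Open Scope classical_set_scope.
Local Open Scope ring_scope.

(* The library's product topology and product sigma-algebra; lengths below are
   Euclidean, and never use the library's max norm. *)
Notation plane R := (R * R)%type (only parsing).

Section plane.
Context {R : realType}.

Definition dot (p q : plane R) : R := p.1 * q.1 + p.2 * q.2.
Definition cross (p q : plane R) : R := p.1 * q.2 - p.2 * q.1.
Definition dist (p q : plane R) : R := Num.sqrt (dot (p - q) (p - q)).

Definition uvec (t : R) : plane R := (cos t, sin t).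
Definition vvec (t : R) : plane R := (- sin t, cos t).

Definition area (X : set (plane R)) : R :=
  fine ((lebesgue_measure \x lebesgue_measure)%E X).

End plane.

Section convex_bodies.
Context {R : realType}.
Implicit Types (K X : set (plane R)) (t : R).

Definition convex_body K : Prop :=
  [/\ K !=set0, compact K & convex_set (K : set (convex_lmodType (plane R)))].

Definition support K t : R := sup [set dot p (uvec t) | p in K].

Definition edge K t : set (plane R) :=
  [set p | K p /\ dot p (uvec t) = support K t].

Definition vplus K t : plane R :=
  xget 0 [set p | edge K t p /\
    forall q, edge K t q -> dot q (vvec t) <= dot p (vvec t)].

Definition vminus K t : plane R :=
  xget 0 [set p | edge K t p /\
    forall q, edge K t q -> dot p (vvec t) <= dot q (vvec t)].

Definition minkowski_comb (l : R) K1 K2 : set (plane R) :=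
  [set (1 - l) *: p + l *: q | p in K1 & q in K2].

Definition diam X : \bar R :=
  ereal_sup ([set 0%E] `|` [set (dist p q)%:E | p in X & q in X]).

Definition hausdorff1_pre (d : R) X : \bar R :=
  ereal_inf [set (\sum_(0 <= i <oo) diam (U i))%E | U in
    [set U : (set (plane R))^nat |
      X `<=` \bigcup_i U i /\ forall i, (diam (U i) <= d%:E)%E]].

(* One-dimensional Hausdorff measure, for the Euclidean metric. *)
Definition hausdorff1 X : \bar R :=
  ereal_sup [set hausdorff1_pre d X | d in [set d : R | 0 < d]].

(* The surface area measure of a body with nonempty interior: the length of
   the part of the boundary having an outer normal [uvec t] with [t] in [A].
   A Borel subset of the circle is given by a set [A] of angles, and [uvec] is
   2pi-periodic.  (For a body without interior this is not the usual
   convention, which counts both sides of a segment.) *)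
Definition surface_area_measure K (A : set R) : \bar R :=
  hausdorff1 (\bigcup_(t in A) edge K t).

Definition has_density_on (m : set R -> \bar R) (D : set R) : Prop :=
  exists f : R -> R,
    [/\ measurable_fun D f, (forall t, D t -> 0 <= f t) &
        forall A : set R, measurable A -> A `<=` D ->
          m A = (\int[lebesgue_measure]_(t in A) (f t)%:E)%E].

End convex_bodies.

Section curve_area.
Context {R : realType}.

(* [v] is the Riemann-Stieltjes integral of [f] against [g] on [a, b]: the
   limit, as the mesh tends to 0, of the sums over tagged partitions
   [a < s_0 < s_1 < ... = b]. *)
Definition is_stieltjes (f g : R -> R) (a b v : R) : Prop :=
  forall e : R, 0 < e -> exists2 d : R, 0 < d &
    forall (s : seq R) (xi : nat -> R),
      itv_partition a b s ->
      (forall i, (i < size s)%N ->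
        nth a (a :: s) i <= xi i <= nth a s i /\
        nth a s i - nth a (a :: s) i < d) ->
      `| \sum_(i < size s) f (xi i) * (g (nth a s i) - g (nth a (a :: s) i))
         - v | < e.

Definition stieltjes (f g : R -> R) (a b : R) : R :=
  xget 0 [set v | is_stieltjes f g a b v].

Definition curve_area (z : R -> plane R) (a b : R) : R :=
  2^-1 * (stieltjes (fun t => (z t).1) (fun t => (z t).2) a b
          - stieltjes (fun t => (z t).2) (fun t => (z t).1) a b).

Definition segment_area (p q : plane R) : R := 2^-1 * cross p q.

(* [z] on [a, b] is a continuous parametrization, of bounded variation, of the
   simple arc [C] oriented from [p] to [q]; [a = b] is allowed, for an arc
   reduced to a point. *)
Definition parametrizes (C : set (plane R)) (p q : plane R)
    (z : R -> plane R) (a b : R) : Prop :=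
  [/\ a <= b,
      {within `[a, b], continuous z},
      bounded_variation a b (fun t => (z t).1) /\
      bounded_variation a b (fun t => (z t).2),
      {in `[a, b] &, injective z} &
      [/\ z a = p, z b = q & z @` `[a, b] = C]].

(* Curve area of an oriented simple arc; its value does not depend on the
   parametrization. *)
Definition arc_area (C : set (plane R)) (p q : plane R) : R :=
  xget 0 [set v | exists z a b,
    parametrizes C p q z a b /\ v = curve_area z a b].

(* For [a < b < a + pi], the boundary arc u_X^{a,b} and its curve area. *)
Definition boundary_arc (X : set (plane R)) (a b : R) : set (plane R) :=
  [set vplus X a] `|` \bigcup_(t in `]a, b[) edge X t `|` [set vminus X b].

Definition boundary_arc_area (X : set (plane R)) (a b : R) : R :=
  arc_area (boundary_arc X a b) (vplus X a) (vminus X b).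

End curve_area.

Section caps.
Context {R : realType}.
Implicit Types (K B D : set (plane R)) (t : R).

Record gerver_constants (p q phi theta : R) : Prop := GerverConstants {
  gerver_range : 0 < phi /\ phi < theta /\ theta < pi / 4;
  gerver_eq1 :
    p * (cos theta - cos phi) - 2 * q * sin phi
    + (theta - phi - 1) * cos theta - sin theta + cos phi + sin phi = 0;
  gerver_eq2 :
    p * (3 * sin theta + sin phi) - 2 * q * cos phi
    + 3 * (theta - phi - 1) * sin theta + 3 * cos theta
    - sin phi + cos phi = 0;
  gerver_eq3 :
    p * cos phi = sin phi + 2^-1 - 2^-1 * cos phi + q * sin phi;
  gerver_eq4 :
    p + pi / 2 - phi - theta
    = q - 2^-1 * (theta - phi) * (1 + p) - 4^-1 * (theta - phi) ^+ 2
}.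

(* Rotation angle pi/2.  [H] is a family of half-planes, indexed by the pairs
   of normal angle and offset. *)
Definition cap K : Prop :=
  [/\ convex_body K,
      support K (pi / 2) = 1,
      support K (3 * pi / 2) = 0 &
      exists2 H : set (R * R),
        (forall t c, H (t, c) -> 0 <= t <= pi \/ t = 3 * pi / 2) &
        K = [set p | forall t c, H (t, c) -> dot p (uvec t) <= c]].

Definition inner_corner K t : plane R :=
  (support K t - 1) *: uvec t + (support K (t + pi / 2) - 1) *: vvec t.

(* [z] is C^1 on [a, b] with derivative [dz], one-sided at the end points. *)
Definition C1_on (z dz : R -> plane R) (a b : R) : Prop :=
  {within `[a, b], continuous dz} /\
  forall t, t \in `[a, b] ->
    (fun s : R => (s - t)^-1 *: (z s - z t)) @ within `[a, b] (t^') --> dz t.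

Definition injectivity_condition K : Prop :=
  [/\ has_density_on (surface_area_measure K) `[0, pi / 2[,
      has_density_on (surface_area_measure K) `]pi / 2, pi] &
      exists2 dx : R -> plane R,
        C1_on (inner_corner K) dx 0 (pi / 2) &
        forall t, 0 < t < pi / 2 ->
          dot (dx t) (uvec t) < 0 /\ 0 < dot (dx t) (vvec t)].

Definition injective_cap K : Prop :=
  [/\ cap K, 22 / 10 <= area K & injectivity_condition K].

Definition triple : Type :=
  (set (plane R) * set (plane R) * set (plane R))%type.

Definition triple_comb (l : R) (T1 T2 : triple) : triple :=
  let: (K1, B1, D1) := T1 in
  let: (K2, B2, D2) := T2 in
  (minkowski_comb l K1 K2, minkowski_comb l B1 B2, minkowski_comb l D1 D2).

(* [phi] and [pi / 2 - phi] are the angles phi^R and phi^L. *)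
Definition calL (phi : R) : set triple := [set T : triple |
  let: (K, B, D) := T in
  [/\ [/\ injective_cap K, convex_body B & convex_body D],
      B `<=` K /\ D `<=` K,
      [/\ (forall t, phi <= t <= pi / 2 -> support K t + support B (pi + t) <= 1),
          support K phi + support B (pi + phi) = 1 &
          support K (pi / 2) + support B (pi + pi / 2) = 1] &
      [/\ (forall t, 0 <= t <= pi / 2 - phi ->
            support K (pi / 2 + t) + support D (3 * pi / 2 + t) <= 1),
          support K (pi / 2 + 0) + support D (3 * pi / 2 + 0) = 1 &
          support K (pi / 2 + (pi / 2 - phi))
            + support D (3 * pi / 2 + (pi / 2 - phi)) = 1]]].

Definition calQ (phi : R) (T : triple) : R :=
  let: (K, B, D) := T in
  let phiR := phi in
  let phiL := pi / 2 - phi in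
  let XB := vplus B (pi + phiR) in
  let YD := vminus D (3 * pi / 2 + phiL) in
  area K
  + boundary_arc_area D (3 * pi / 2) (3 * pi / 2 + phiL)
  + segment_area YD (inner_corner K phiL)
  - curve_area (inner_corner K) phiR phiL
  + segment_area (inner_corner K phiR) XB
  + boundary_arc_area B (pi + phiR) (3 * pi / 2).

End caps.

(* Main.v *)
From HB Require Import structures.
From mathcomp Require Import all_boot all_order all_algebra.
From mathcomp Require Import all_classical all_reals all_analysis.
From mathcomp Require Import measurable_realfun ring lra.
Require Import Defs.

Set Implicit Arguments.
Unset Strict Implicit.
Unset Printing Implicit Defensive.

Import Order.TTheory GRing.Theory Num.Theory.
Import numFieldNormedType.Exports.

Local Open Scope classical_set_scope.
Local Open Scope ring_scope.

(** Let [al t] and [ga t] be the coordinates of the inner corner of [K] in the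
    rotating frame ([uvec t], [vvec t]): up to the constant 1 they are the
    support function of [K] at [t] and at [t + pi / 2]. The inner corner being
    of class C1, so are [al] and [ga] on [0, pi / 2], and two terms of the
    functional are integrals of quadratic densities in them, with
    [L = pi / 2 - phi]:
    - twice the area of [K] is the integral over [0, pi / 2] of
      [(al + 1) ^+ 2 - al' ^+ 2 + (ga + 1) ^+ 2 - ga' ^+ 2]
      ([standing_area]);
    - twice the curve area of the inner corner is the integral over [phi, L]
      of [al ^+ 2 + ga ^+ 2 + al * ga' - ga * al'] ([curve_area_C1]).

    The bodies [B] and [D] need not be smooth. The arc of [B] runs from a
    supporting line of [B] through the inner corner at time [phi] down to the
    horizontal axis, which supports [B] too. Replacing the arc by the corner of
    these two lines changes the curve area by the area cut off between the arc
    and the lines. With the corner, the terms of [B] add up to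
    [- (al phi ^+ 2 * tan phi + al phi * ga phi) / 2]; the area cut off is an
    integral over heights [y] of the least value of [dot p (uvec phi)] on the
    points of [B] below [y], which is convex in [B] because a Minkowski
    combination of such points is a point of the combined body below the same
    height ([left_arc_value], [profile_minkowski]). The body [D] is the mirror
    image of this situation ([right_arc_value]).

    There remains a quadratic function of ([al], [ga]). Along a Minkowski
    segment it exceeds its chord by [lambda * (1 - lambda)] times minus its
    homogeneous part at the difference ([a], [c]) of the two pairs, and
    [a (pi / 2) = c 0 = 0] since all caps have height 1. Up to derivatives of
    [a ^+ 2 * tan], [c ^+ 2 * tan] and [a * c], the densities of that part are
    minus squares, and the boundary terms left over form minus the square of a
    combination of [a L] and [c L]: hence it is nonpositive
    ([defect_form_le0]).

    Two tools replace integration theory. An integral of a continuous function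
    is a difference of values of an antiderivative; and a function whose
    increments are small against those of a monotone function, uniformly on
    short intervals, is constant ([eq_of_small_increments]). The second one
    identifies areas and Stieltjes integrals along curves that are merely
    continuous. *)

(** * Increments and Stieltjes integrals *)

Section increments.
Context {R : realType}.
Implicit Types (a b s t d e : R).

Lemma eq0_of_le_eps (x c : R) : (forall e, 0 < e -> `|x| <= e * c) -> x = 0.
Proof.
move=> H; apply/eqP; rewrite -normr_le0; apply/ler_addgt0Pr => e e0.
have c1 : 0 < `|c| + 1 by rewrite ltr_wpDl.
have := H _ (divr_gt0 e0 c1); rewrite add0r => /le_trans; apply.
rewrite mulrAC ler_pdivrMr// ler_wpM2l ?(ltW e0)//.
by rewrite (le_trans (ler_norm _))// lerDl.
Qed.

Lemma uniform_mesh a b d : a <= b -> 0 < d ->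
  exists2 n : nat, (0 < n)%N & (b - a) / n%:R < d.
Proof.
move=> ab d0.
have := archi_boundP (divr_ge0 (_ : 0 <= b - a) (ltW d0)).
rewrite subr_ge0 => /(_ ab); set n := Num.bound _ => H.
have n0 : (0 < n)%N.
  rewrite lt0n; apply/eqP => n0; move: H; rewrite n0.
  by rewrite ltNge divr_ge0 ?subr_ge0// ltW.
exists n => //; rewrite ltr_pdivrMr ?ltr0n// mulrC.
by move: H; rewrite ltr_pdivrMr.
Qed.

(** Cutting [a, b] into equal cells shorter than [d], the increments of [m]
    telescope, so the increment of [G] is at most [e * (m b - m a)] for every
    [e]. *)
Lemma eq_of_small_increments (G m : R -> R) a b : a <= b ->
  (forall e, 0 < e -> exists2 d : R, 0 < d &
    forall s t, a <= s -> s <= t -> t <= b -> t - s < d ->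
      `|G t - G s| <= e * (m t - m s)) ->
  G b = G a.
Proof.
move=> ab H; apply/eqP; rewrite -subr_eq0; apply/eqP.
apply: (@eq0_of_le_eps _ (m b - m a)) => e /H [d d0 {}H].
have [n n0 nd] := uniform_mesh ab d0.
pose x (i : nat) := a + (b - a) / n%:R * i%:R.
have nn : n%:R != 0 :> R by rewrite pnatr_eq0 -lt0n.
have xn : x n = b by rewrite /x divfK// addrC subrK.
have h0 : 0 <= (b - a) / n%:R by rewrite divr_ge0 ?subr_ge0.
have xS i : x i.+1 = x i + (b - a) / n%:R.
  by rewrite /x -natr1 mulrDr mulr1 addrA.
have xle i j : (i <= j)%N -> x i <= x j.
  by move=> ij; rewrite lerD2l ler_wpM2l// ler_nat.
have x0 : x 0%N = a by rewrite /x mulr0 addr0.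
have : forall i, (i <= n)%N -> `|G (x i) - G a| <= e * (m (x i) - m a).
  elim=> [_|i IH i_n]; first by rewrite x0 !subrr normr0 mulr0.
  have -> : G (x i.+1) - G a = (G (x i.+1) - G (x i)) + (G (x i) - G a) by ring.
  apply: le_trans (ler_normD _ _) _.
  have -> : e * (m (x i.+1) - m a) =
    e * (m (x i.+1) - m (x i)) + e * (m (x i) - m a) by ring.
  apply: lerD; last exact/IH/ltnW.
  apply: H; rewrite ?xle// -?x0 ?xle// -?xn ?xle//.
  by rewrite xS addrC addKr.
by move=> /(_ n (leqnn _)); rewrite xn.
Qed.

Lemma partition_telescope (F : R -> R) a b (s : seq R) : itv_partition a b s ->
  \sum_(i < size s) (F (nth a s i) - F (nth a (a :: s) i)) = F b - F a.
Proof.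
suff H : forall c, itv_partition a b s ->
  \sum_(i < size s) (F (nth c s i) - F (nth c (a :: s) i)) = F b - F a.
  exact: H.
move=> c; elim: s a => [a /itv_partition_nil ->|x s IH a P] /=.
  by rewrite big_ord0 subrr.
rewrite big_ord_recl /= (eq_bigr (fun i : 'I_(size s) =>
  F (nth c s i) - F (nth c (x :: s) i))); last by [].
rewrite IH; last exact: itv_partition_cons P.
by ring.
Qed.

Lemma partition_cell a b (s : seq R) i : itv_partition a b s -> (i < size s)%N ->
  [/\ a <= nth a (a :: s) i, nth a (a :: s) i <= nth a s i & nth a s i <= b].
Proof.
move=> P i_s.
have E j : (j < (size s).+1)%N -> nth a (a :: s) j = nth b (a :: s) j.
  by move=> js; apply: set_nth_default.
split.
- by rewrite E ?itv_partition_nth_ge// ltnW.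
- rewrite E; last exact: ltnW.
  have -> : nth a s i = nth b (a :: s) i.+1 by rewrite -E.
  by apply: (@nondecreasing_fun_itv_partition _ _ a b id s _ P i i_s) => x y.
- by rewrite -[nth a s i]/(nth a (a :: s) i.+1) E// itv_partition_nth_le.
Qed.

(** If the terms of the sums agree with the increments of [V] up to [e] times
    the increments of one function [m], the errors telescope. In the uses, [m]
    measures the variation of the integrator. *)
Lemma is_stieltjes_of_increments (f g V m : R -> R) a b : a <= b ->
  (forall e, 0 < e -> exists2 d : R, 0 < d &
    forall s x t, a <= s -> s <= x -> x <= t -> t <= b -> t - s < d ->
      `|f x * (g t - g s) - (V t - V s)| <= e * (m t - m s)) ->
  is_stieltjes f g a b (V b - V a).
Proof.
move=> ab H e e0.
have c1 : 0 < `|m b - m a| + 1 by rewrite ltr_wpDl.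
have [d d0 {}H] := H _ (divr_gt0 e0 c1).
exists d => // s xi P Hs.
rewrite -(partition_telescope V P) -sumrB.
move: H; set e' := e / _ => H.
apply: (@le_lt_trans _ _ (e' * (m b - m a))); last first.
  rewrite mulrAC ltr_pdivrMr// ltr_pM2l//.
  by rewrite (le_lt_trans (ler_norm _))// ltrDl.
rewrite -(partition_telescope m P) mulr_sumr.
apply: le_trans (ler_norm_sum _ _ _) _.
apply: ler_sum => i _.
have [c1' c2 c3] := partition_cell P (ltn_ord i).
have [/andP[h1 h2] h3] := Hs _ (ltn_ord i).
exact: H.
Qed.

Lemma fine_partition a b d : a <= b -> 0 < d ->
  exists2 s : seq R, itv_partition a b s &
    forall i, (i < size s)%N -> nth a s i - nth a (a :: s) i < d.
Proof.
move=> ab d0; have [n n0 nd] := uniform_mesh ab d0.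
have [ab'|] := eqVneq a b.
  by exists [::] => //; rewrite /itv_partition /= ab'.
move=> nab; have {}ab : a < b by rewrite lt_neqAle nab.
pose x (i : nat) := a + (b - a) / n%:R * i%:R.
have nn : n%:R != 0 :> R by rewrite pnatr_eq0 -lt0n.
have h0 : 0 < (b - a) / n%:R by rewrite divr_gt0 ?subr_gt0// ltr0n.
have xS i : x i.+1 = x i + (b - a) / n%:R.
  by rewrite /x -natr1 mulrDr mulr1 addrA.
have x0 : x 0%N = a by rewrite /x mulr0 addr0.
exists [seq x i | i <- iota 1 n]; last first.
  move=> i; rewrite size_map size_iota => i_n.
  have -> : a :: [seq x i | i <- iota 1 n] = [seq x i | i <- iota 0 n.+1].
    by rewrite /= x0.
  rewrite !(nth_map 0%N) ?size_iota//; last exact: ltnW.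
  by rewrite !nth_iota ?add1n ?add0n ?xS ?[x i + _]addrC ?addrK//; exact: ltnW.
split.
- rewrite -{1}x0 path_map.
  have : path ltn 0 (iota 1 n).
    by have := iota_ltn_sorted 0 n.+1.
  apply: sub_path => i j /= ij.
  by rewrite ltrD2l ltr_pM2l// ltr_nat.
- rewrite -{1}x0 last_map -nth_last size_iota nth_iota ?ltn_predL//.
  by rewrite add1n prednK// /x divfK// addrC subrK.
Qed.

Lemma is_stieltjes_unique (f g : R -> R) a b (v w : R) : a <= b ->
  is_stieltjes f g a b v -> is_stieltjes f g a b w -> v = w.
Proof.
move=> ab Hv Hw; apply/eqP; rewrite -subr_eq0; apply/eqP.
apply: (@eq0_of_le_eps _ 2) => e e0.
have [d d0 {}Hv] := Hv _ e0.
have [d' d'0 {}Hw] := Hw _ e0.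
have dd : 0 < Num.min d d' by rewrite lt_min d0.
have [s P Hs] := fine_partition ab dd.
pose xi i := nth a (a :: s) i.
have {}Hv : _ := Hv s xi P _; have {}Hw : _ := Hw s xi P _.
have {}/Hv Hv : forall i, (i < size s)%N ->
    nth a (a :: s) i <= xi i <= nth a s i /\ nth a s i - nth a (a :: s) i < d.
  move=> i i_s; have [_ c _] := partition_cell P i_s.
  by rewrite lexx c; split => //; have := Hs _ i_s; rewrite lt_min => /andP[].
have {}/Hw Hw : forall i, (i < size s)%N ->
    nth a (a :: s) i <= xi i <= nth a s i /\ nth a s i - nth a (a :: s) i < d'.
  move=> i i_s; have [_ c _] := partition_cell P i_s.
  by rewrite lexx c; split => //; have := Hs _ i_s; rewrite lt_min => /andP[].
move: Hv Hw; set S := \sum_(i < _) _ => Hv Hw.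
have -> : v - w = (S - w) - (S - v) by ring.
rewrite (le_trans (ler_normB _ _))// mulr2n mulrDr mulr1.
by rewrite lerD// ltW.
Qed.

Lemma stieltjes_eq (f g : R -> R) a b (v : R) : a <= b ->
  is_stieltjes f g a b v -> stieltjes f g a b = v.
Proof.
move=> ab H; apply: (is_stieltjes_unique ab _ H).
exact: (@xgetPex _ 0 [set w | is_stieltjes f g a b w] (ex_intro _ v H)).
Qed.

End increments.

(** * Derivatives and antiderivatives on the line *)

Section calculus.
Context {R : realType}.
Implicit Types (f g df dg F G : R -> R) (a b x : R).

Lemma is_derive_continuous f x d : is_derive x 1 f d -> {for x, continuous f}.
Proof.
by move=> [fx _]; exact/differentiable_continuous/derivable1_diffP.
Qed.

(** The rules of differentiation for functions written with explicit
    arguments: the derivative of an expression is found by composing them along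
    its syntax. *)
Lemma derive_add f g x d d' : is_derive x 1 f d -> is_derive x 1 g d' ->
  is_derive x 1 (fun t => f t + g t) (d + d').
Proof. by move=> Hf Hg; exact: is_deriveD. Qed.

Lemma derive_opp f x d : is_derive x 1 f d ->
  is_derive x 1 (fun t => - f t) (- d).
Proof. by move=> Hf; exact: is_deriveN. Qed.

Lemma derive_mul f g x d d' : is_derive x 1 f d -> is_derive x 1 g d' ->
  is_derive x 1 (fun t => f t * g t) (f x * d' + g x * d).
Proof. by move=> Hf Hg; exact: is_deriveM. Qed.

Lemma derive_cst (c : R) x : is_derive x 1 (fun _ => c) 0.
Proof. exact: is_derive_cst. Qed.

Lemma derive_id x : is_derive x 1 (fun t : R => t) 1.
Proof. exact: is_derive_id. Qed.

Lemma derive_shift f (c x d : R) : is_derive (x + c) 1 f d ->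
  is_derive x 1 (fun t => f (t + c)) d.
Proof.
move=> H.
have Hs : is_derive x 1 (fun t : R => t + c) 1.
  by apply: is_derive_eq (derive_add (derive_id x) (derive_cst c x)) _; rewrite addr0.
have := @is_derive1_comp _ f (fun t => t + c) x d 1 H Hs.
by rewrite mulr1.
Qed.

Lemma derive_cos x : is_derive x 1 (fun t : R => cos t) (- sin x).
Proof. exact: is_derive_cos. Qed.

Lemma derive_sin x : is_derive x 1 (fun t : R => sin t) (cos x).
Proof. exact: is_derive_sin. Qed.

Lemma derive_continuous f df : (forall x, is_derive x 1 f (df x)) ->
  continuous f.
Proof. by move=> H x; exact: is_derive_continuous (H x). Qed.

Lemma derive_le0_le f df a b : a <= b ->
  (forall x, a <= x <= b -> is_derive x 1 f (df x)) ->
  (forall x, a <= x <= b -> df x <= 0) -> f b <= f a.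
Proof.
move=> ab H H0.
have [| |c cab] := @MVT_segment _ f df a b ab.
- by move=> x; rewrite in_itv /= => /andP[/ltW ax /ltW xb]; apply: H; rewrite ax.
- apply: continuous_in_subspaceT => x; rewrite inE /= in_itv /= => xab.
  exact: is_derive_continuous (H _ xab).
move: cab; rewrite in_itv /= => cab E.
by rewrite -subr_le0 E mulr_le0_ge0 ?H0// subr_ge0.
Qed.

Lemma derive0_eq f a b : a <= b ->
  (forall x, a <= x <= b -> is_derive x 1 f 0) -> f b = f a.
Proof.
move=> ab H; apply/eqP; rewrite eq_le; apply/andP; split.
  exact: (@derive_le0_le f (fun=> 0)).
rewrite -lerN2; apply: (@derive_le0_le (fun x => - f x) (fun=> 0)) => //.
by move=> x /H {}H; rewrite -oppr0; exact: derive_opp.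
Qed.

Lemma derive_bound f df a b M : a <= b ->
  (forall x, a <= x <= b -> is_derive x 1 f (df x)) ->
  (forall x, a <= x <= b -> `|df x| <= M) -> `|f b - f a| <= M * (b - a).
Proof.
move=> ab H H0.
have [| |c cab E] := @MVT_segment _ f df a b ab.
- by move=> x; rewrite in_itv /= => /andP[/ltW ax /ltW xb]; apply: H; rewrite ax.
- apply: continuous_in_subspaceT => x; rewrite inE /= in_itv /= => xab.
  exact: is_derive_continuous (H _ xab).
move: cab; rewrite in_itv /= => cab.
by rewrite E normrM [`|b - a|]ger0_norm ?subr_ge0// ler_wpM2r ?subr_ge0 ?H0.
Qed.

Lemma segment_uniform_continuity f a b : {within `[a, b], continuous f} ->
  forall e, 0 < e -> exists2 d : R, 0 < d &
    forall x y, a <= x <= b -> a <= y <= b -> `|x - y| < d -> `|f x - f y| < e.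
Proof.
move=> /subspace_continuousP cf e e0.
have /compact_near_coveringP H := @segment_compact _ a b.
pose P (d : R) (x : R) := a <= x <= b -> forall y, a <= y <= b ->
   `|x - y| < d -> `|f x - f y| < e.
have HP x : `[a, b]%classic x -> \forall x' \near x & d \near 0^'+, P d x'.
  rewrite /= in_itv /= => xab.
  have e2 : 0 < e / 2 by rewrite divr_gt0.
  have xab' : `[a, b]%classic x by rewrite /= in_itv.
  have := cf x xab' _ (nbhsx_ballx (f x) _ e2).
  rewrite /= /nbhs /= /within /= => -[d /= d0 Hd].
  have d2 : 0 < d / 2 by rewrite divr_gt0.
  exists (ball x (d / 2), [set r | 0 < r < d / 2]); first split => /=.
  - exact: nbhsx_ballx.
  - exists (d / 2) => //= r /=; rewrite sub0r normrN => rd r0.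
    by rewrite r0 (le_lt_trans (ler_norm _)).
  move=> [x' r] [/= xx' /andP[r0 rd]] x'ab y yab xy.
  have A1 : ball (f x) (e / 2) (f x').
    apply: Hd => //=; rewrite /ball /= in xx' *.
    by apply: lt_trans xx' _; lra.
  have A2 : ball (f x) (e / 2) (f y).
    apply: Hd => //=; rewrite /ball /= in xx' *.
    have -> : x - y = (x - x') + (x' - y) by ring.
    by apply: le_lt_trans (ler_normD _ _) _; lra.
  rewrite /ball /= in A1 A2.
  have -> : f x' - f y = (f x - f y) - (f x - f x') by ring.
  by apply: le_lt_trans (ler_normB _ _) _; lra.
have FR : Filter (0^'+ : set_system R) by apply: (@filter_filter _ _ (at_right_proper_filter 0)).
have {FR}HQ := H R (0^'+) P FR HP.
near (0:R)^'+ => d.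
exists d; first by near: d; exact: nbhs_right_gt.
have Hd : `[a, b]%classic `<=` P d by near: d.
move=> x y xab; apply: Hd => //=.
Unshelve. all: by end_near. Qed.

Lemma segment_bounded f a b : {within `[a, b], continuous f} ->
  exists2 M : R, 0 < M & forall x, a <= x <= b -> `|f x| <= M.
Proof.
move=> cf; have [ab|ba] := leP a b; last first.
  exists 1 => // x /andP[ax xb].
  by move: (le_lt_trans (le_trans ax xb) ba); rewrite ltxx.
have cn : {within `[a, b], continuous (fun x => `|f x|)}.
  by move=> x; apply: (@cvg_comp _ _ _ f (fun y : R => `|y|) _ _ _ (cf x)); exact: norm_continuous.
have [c _ Hc] := EVT_max ab cn.
exists (`|f c| + 1); first by rewrite ltr_wpDl.
by move=> x xab; rewrite (le_trans (Hc x _))// lerDl.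
Qed.

(** Integrating from [- n%:R] gives an antiderivative on the right of
    [- n%:R] only; normalized to vanish at [0], these agree on their common
    domains and patch together to the whole line. *)
Lemma antiderivative_exists f : continuous f ->
  exists F, forall x, is_derive x 1 F (f x).
Proof.
move=> cf.
pose G n x := (\int[lebesgue_measure]_(t in `[(- n%:R : R), x]) f t)%R.
have dG n x : - n%:R < x -> is_derive x 1 (G n) (f x).
  move=> nx.
  have x1 : x < x + 1 by rewrite ltrDl.
  have int : lebesgue_measure.-integrable `[(- n%:R : R), x + 1] (EFin \o f).
    by apply: continuous_compact_integrable; [exact: segment_compact|exact: continuous_subspaceT].
  have [d1 d2] := continuous_FTC1_closed x1 int nx (cf x).
  by apply: DeriveDef => //; rewrite -derive1E.
have dGG n m x y : - n%:R < x -> - m%:R < x -> x <= y ->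
    G n y - G m y = G n x - G m x.
  move=> nx mx xy.
  apply: (@derive0_eq (fun t => G n t - G m t)) => // z /andP[xz zy].
  apply: is_derive_eq (derive_add (dG n z _) (derive_opp (dG m z _))) _; last by rewrite subrr.
    exact: lt_le_trans xz.
  exact: lt_le_trans xz.
pose N x := (Num.bound `|x|).+1.
have NP x : - (N x)%:R < x.
  rewrite ltrNl; apply: (@lt_trans _ _ (Num.bound `|x|)%:R); last by rewrite ltr_nat.
  by apply: le_lt_trans (archi_boundP (normr_ge0 x)); rewrite -normrN ler_norm.
have N0 n : - (n.+1)%:R < 0 :> R by rewrite oppr_lt0 ltr0n.
have Geq n x : - n.+1%:R < x -> G (N x) x - G (N x) 0 = G n.+1 x - G n.+1 0.
  move=> nx; have [x0|/ltW x0] := leP x 0.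
  - by have := dGG _ _ _ _ (NP x) nx x0; rewrite !{1}/N; lra.
  - by have := dGG _ _ _ _ (N0 (Num.bound `|x|)) (N0 n) x0; rewrite !{1}/N; lra.
exists (fun x => G (N x) x - G (N x) 0) => x.
apply: (@near_eq_is_derive _ _ _ (fun t => G (N x) t - G (N x) 0)); last first.
  apply: is_derive_eq (derive_add (dG _ _ (NP x)) (derive_cst _ x)) _.
  by rewrite addr0.
near=> y; apply/esym/Geq.
by near: y; exact: lt_nbhsr (NP x).
Unshelve. all: by end_near. Qed.

(** The derivative of [N - f ^+ 2 * tan (t + c)] is minus the square of
    [df + f * tan (t + c)]. The shift [c] decides at which points the boundary
    term vanishes: this is a sharp Wirtinger inequality with one end point of
    [f] fixed and the other free or null. *)
Lemma tan_comparison f df N (c a b : R) : a <= b ->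
  (forall x, is_derive x 1 f (df x)) ->
  (forall x, is_derive x 1 N (f x ^+ 2 - df x ^+ 2)) ->
  (forall x, a <= x <= b -> 0 < cos (x + c)) ->
  N b - N a <= f b ^+ 2 * tan (b + c) - f a ^+ 2 * tan (a + c).
Proof.
move=> ab Hf HN Hc.
suff : N b + - ((f b * f b) * tan (b + c)) <= N a + - ((f a * f a) * tan (a + c)).
  by lra.
apply: (@derive_le0_le (fun x => N x + - ((f x * f x) * tan (x + c)))
  (fun x => - (df x + f x * tan (x + c)) ^+ 2)) => // x xab; last first.
  by rewrite oppr_le0 sqr_ge0.
have cx := Hc _ xab.
have dt : is_derive x 1 (fun t => tan (t + c)) (1 + tan (x + c) ^+ 2).
  apply: derive_shift; apply: is_derive_eq (is_derive_tan _) _.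
    by rewrite gt_eqF.
  by rewrite cos2_tan2// gt_eqF.
apply: is_derive_eq (derive_add (HN x) (derive_opp
    (derive_mul (derive_mul (Hf x) (Hf x)) dt))) _.
by ring.
Qed.

End calculus.

(** * Nonpositivity of the quadratic defect *)

Section wirtinger.
Context {R : realType}.
Implicit Types (f df a da c dc N Na Nc M : R -> R) (x phi : R).

Lemma cos_pihalfB (x : R) : cos (pi / 2 - x) = sin x.
Proof. by rewrite -cosN opprB cosBpihalf. Qed.

Lemma sin_pihalfB (x : R) : sin (pi / 2 - x) = cos x.
Proof. by rewrite -[pi / 2 - x]opprB sinN sinBpihalf opprK. Qed.

(** Where [tan] has a pole at the end of the interval, the comparison is
    applied with a shifted weight; this lets the shift tend to [0]. *)
Lemma le_tan_right (X k x d : R) : cos x != 0 -> 0 < d ->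
  (forall e, 0 < e < d -> X <= k * tan (x + e)) -> X <= k * tan x.
Proof.
move=> cx d0 H; apply/ler_addgt0Pr => eta eta0.
have : {for x, continuous (fun t => k * tan t)}.
  by apply: is_derive_continuous (derive_mul (derive_cst k x) (is_derive_tan cx)).
move=> /cvgrPdist_lt /(_ _ eta0) [r /= r0 Hr].
pose e := Num.min (r / 2) (d / 2).
have e0 : 0 < e by rewrite lt_min !divr_gt0.
have er : e < r by rewrite gt_min; apply/orP; left; lra.
have ed : e < d by rewrite gt_min; apply/orP; right; lra.
apply: le_trans (H e _) _; first by rewrite e0.
have := Hr (x + e); rewrite /ball_ /= opprD addNKr normrN gtr0_norm// => /(_ er).
by rewrite ltr_norml => /andP[h1 h2]; lra.
Qed.

(** On [0, phi] and [L, pi / 2] each square is completed with the weight [tan]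
    or its translates; on [phi, L] the density of [Na - M] plus that of [a * c]
    is [- (da - c) ^+ 2], and the remaining density [c ^+ 2 - dc ^+ 2] is
    estimated on all of [0, L], from its zero at [0]. *)
Lemma defect_form_le0 a da c dc Na Nc M phi L : 0 < phi < pi / 4 ->
  L = pi / 2 - phi ->
  (forall x, is_derive x 1 a (da x)) -> (forall x, is_derive x 1 c (dc x)) ->
  (forall x, is_derive x 1 Na (a x ^+ 2 - da x ^+ 2)) ->
  (forall x, is_derive x 1 Nc (c x ^+ 2 - dc x ^+ 2)) ->
  (forall x, is_derive x 1 M
     (a x ^+ 2 + c x ^+ 2 + a x * dc x - c x * da x)) ->
  a (pi / 2) = 0 -> c 0 = 0 ->
  (Na (pi / 2) - Na 0) + (Nc (pi / 2) - Nc 0) - (M L - M phi)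
  - a phi * c phi - a L * c L - tan phi * (a phi ^+ 2 + c L ^+ 2) <= 0.
Proof.
move=> /andP[phi0 phi4] LE Ha Hc HNa HNc HM a1 c0.
have pi0 : 0 < pi :> R := pi_gt0 R.
have sinphi : 0 < sin phi by apply: sin_gt0_pi; rewrite phi0/=; lra.
have cosphi : 0 < cos phi by apply: cos_gt0_pihalf; lra.
have tanL : tan L = (tan phi)^-1.
  by rewrite /tan LE sin_pihalfB cos_pihalfB invf_div.
have tphi : 0 < tan phi by rewrite divr_gt0.
have h1 : Na phi - Na 0 <= a phi ^+ 2 * tan phi.
  have := @tan_comparison _ a da Na 0 0 phi (ltW phi0) Ha HNa.
  rewrite !addr0 tan0 mulr0 subr0; apply => x /andP[x0 xp].
  by rewrite addr0; apply: cos_gt0_pihalf; lra.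
have h2 : Na L - M L + a L * c L <= Na phi - M phi + a phi * c phi.
  apply: (@derive_le0_le _ (fun x => (Na x + - M x) + a x * c x)
     (fun x => - (da x - c x) ^+ 2)); first by rewrite LE; lra.
  - move=> x _; apply: is_derive_eq (derive_add (derive_add (HNa x) (derive_opp (HM x))) (derive_mul (Ha x) (Hc x))) _.
    by ring.
  - by move=> x _; rewrite oppr_le0 sqr_ge0.
have h3 : Na (pi / 2) - Na L <= - (a L ^+ 2 / tan phi).
  rewrite -tanL -mulNr -[leRHS]mulrNN opprK -tanN.
  apply: (@le_tan_right _ _ _ phi) => //.
    by rewrite cosN LE cos_pihalfB gt_eqF.
  move=> e /andP[e0 ep].
  have -> : - L + e = - (L - e) by ring.
  rewrite tanN mulrN -mulNr.
  have := @tan_comparison _ a da Na (- e) L (pi / 2) _ Ha HNa.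
  rewrite a1 expr0n mul0r sub0r mulNr; apply; first by rewrite LE; lra.
  move=> x /andP[x1 x2]; apply: cos_gt0_pihalf.
  by rewrite LE in x1; lra.
have h4 : Nc L - Nc 0 <= - (c L ^+ 2 * tan phi).
  rewrite -mulrN -tanN.
  apply: (@le_tan_right _ _ _ phi) => //.
    by rewrite cosN gt_eqF.
  move=> e /andP[e0 ep].
  have -> : - phi + e = L + (e - pi / 2) by rewrite LE; ring.
  have := @tan_comparison _ c dc Nc (e - pi / 2) 0 L _ Hc HNc.
  rewrite c0 expr0n mul0r subr0; apply; first by rewrite LE; lra.
  move=> x /andP[x1 x2]; apply: cos_gt0_pihalf.
  by rewrite LE in x2; lra.
have h5 : Nc (pi / 2) - Nc L <= c L ^+ 2 * tan phi.
  have := @tan_comparison _ c dc Nc (- (pi / 2)) L (pi / 2) _ Hc HNc.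
  rewrite subrr tan0 mulr0 sub0r.
  have -> : L - pi / 2 = - phi by rewrite LE; ring.
  rewrite tanN mulrN opprK; apply; first by rewrite LE; lra.
  move=> x /andP[x1 x2]; apply: cos_gt0_pihalf.
  by rewrite LE in x1; lra.
have sq : 0 <= a L ^+ 2 / tan phi + 2 * (a L * c L) + c L ^+ 2 * tan phi.
  have -> : a L ^+ 2 / tan phi + 2 * (a L * c L) + c L ^+ 2 * tan phi =
    (a L + c L * tan phi) ^+ 2 / tan phi.
    by field; rewrite gt_eqF.
  by rewrite divr_ge0 ?sqr_ge0// ltW.
by rewrite mulrDr ![tan phi * _]mulrC; lra.
Qed.

End wirtinger.

(** * Areas of curves *)

Section curve_areas.
Context {R : realType}.
Implicit Types (f g X Y dX dY psi Psi V m : R -> R) (a b s t u v x : R).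

(** On a segment given by its end points, and in either direction, because
    arcs are followed both upwards and downwards. *)
Definition monotone_on f a b : Prop :=
  (forall s t, a <= s -> s <= t -> t <= b -> f s <= f t) \/
  (forall s t, a <= s -> s <= t -> t <= b -> f t <= f s).

Lemma monotone_on_modulus f a b : monotone_on f a b -> exists m,
  forall s t, a <= s -> s <= t -> t <= b -> `|f t - f s| <= m t - m s.
Proof.
case=> H; [exists f|exists (fun u => - f u)] => s t sa st tb.
  by rewrite ger0_norm// subr_ge0; exact: H.
rewrite distrC ger0_norm ?subr_ge0; last exact: H.
by rewrite opprK addrC.
Qed.

Lemma monotone_on_between f a b s x t : monotone_on f a b ->
  a <= s -> s <= x -> x <= t -> t <= b ->
  `|f x - f s| <= `|f t - f s| /\ `|f t - f x| <= `|f t - f s|.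
Proof.
move=> H sa sx xt tb.
have xb : x <= b by exact: le_trans tb.
have ax : a <= x by exact: le_trans sx.
case: H => H; have A := H _ _ sa sx xb; have B := H _ _ ax xt tb.
  by split; rewrite !ger0_norm; lra.
by split; rewrite !ler0_norm; lra.
Qed.

Lemma monotone_on_bounded_variation f a b : a <= b -> monotone_on f a b ->
  bounded_variation a b f.
Proof.
move=> ab; case=> H.
  apply: nondecreasing_bounded_variation => s t.
  by rewrite !in_itv /= => /andP[sa _] /andP[_ tb] st; exact: H.
have -> : f = \- (\- f) by apply/funext => u /=; rewrite opprK.
apply: bounded_variationN.
apply: nondecreasing_bounded_variation => s t.
by rewrite !in_itv /= => /andP[sa _] /andP[_ tb] st; rewrite lerN2; exact: H.
Qed.

Lemma monotone_on_comp f g a b u v : monotone_on f a b -> monotone_on g u v ->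
  (forall s, a <= s <= b -> u <= f s <= v) ->
  monotone_on (fun s => g (f s)) a b.
Proof.
move=> Hf Hg Hfr.
have fr s t : a <= s -> s <= t -> t <= b ->
   [/\ u <= f s, f s <= v, u <= f t & f t <= v].
  move=> sa st tb.
  move: (Hfr s) (Hfr t); rewrite sa tb (le_trans st tb) (le_trans sa st) /=.
  by move=> /(_ isT)/andP[-> ->] /(_ isT)/andP[-> ->].
case: Hf Hg => Hf [Hg|Hg]; [left|right|right|left] => s t sa st tb;
  have [h1 h2 h3 h4] := fr s t sa st tb; apply: Hg => //; exact: Hf.
Qed.

Lemma is_stieltjes_C1 f g X Y dY V a b : a <= b ->
  (forall s, a <= s <= b -> f s = X s) ->
  (forall s, a <= s <= b -> g s = Y s) ->
  continuous X -> continuous dY -> (forall s, is_derive s 1 Y (dY s)) ->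
  (forall s, is_derive s 1 V (X s * dY s)) ->
  is_stieltjes f g a b (V b - V a).
Proof.
move=> ab Hf Hg cX cdY HY HV.
apply: (@is_stieltjes_of_increments _ f g V (fun t => t)) => // e e0.
have [M M0 HM] := segment_bounded (continuous_subspaceT cdY : {within `[a, b], continuous dY}).
have [d d0 Hd] := segment_uniform_continuity
  (continuous_subspaceT cX : {within `[a, b], continuous X}) (divr_gt0 e0 M0).
exists d => // s x t sa sx xt tb ts.
have st : s <= t by exact: le_trans xt.
have xab : a <= x <= b by rewrite (le_trans sa)// (le_trans xt).
rewrite Hf// !Hg ?sa ?tb ?(le_trans st)// ?(le_trans sa)//.
have -> : X x * (Y t - Y s) - (V t - V s) =
   (X x * Y t + - V t) - (X x * Y s + - V s) by ring.
have HD u : is_derive u 1 (fun u => X x * Y u + - V u) (X x * dY u + - (X u * dY u)).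
  apply: is_derive_eq (derive_add (derive_mul (derive_cst (X x) u) (HY u)) (derive_opp (HV u))) _.
  by ring.
apply: (derive_bound st (fun u _ => HD u)) => u /andP[su ut].
have uab : a <= u <= b by rewrite (le_trans sa)// (le_trans ut).
rewrite -mulrBl normrM -[e](divfK (lt0r_neq0 M0)).
apply: ler_pM => //; last exact: HM.
apply/ltW/Hd => //.
by rewrite ltr_norml; apply/andP; split; lra.
Qed.

Lemma curve_area_C1 (z : R -> plane R) X Y dX dY M a b : a <= b ->
  (forall s, a <= s <= b -> z s = (X s, Y s)) ->
  continuous dX -> continuous dY ->
  (forall s, is_derive s 1 X (dX s)) -> (forall s, is_derive s 1 Y (dY s)) ->
  (forall s, is_derive s 1 M (X s * dY s - Y s * dX s)) ->
  curve_area z a b = 2^-1 * (M b - M a).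
Proof.
move=> ab Hz cdX cdY HX HY HM.
have cX := derive_continuous HX; have cY := derive_continuous HY.
have [V HV] : exists V, forall s, is_derive s 1 V (X s * dY s).
  by apply: antiderivative_exists => s; exact: (continuousM (cX s) (cdY s)).
have HW s : is_derive s 1 (fun s => V s + - M s) (Y s * dX s).
  by apply: is_derive_eq (derive_add (HV s) (derive_opp (HM s))) _; ring.
rewrite /curve_area (stieltjes_eq ab (is_stieltjes_C1 ab _ _ cX cdY HY HV)) => [|s /Hz->|s /Hz->]//.
rewrite (stieltjes_eq ab (is_stieltjes_C1 ab _ _ cY cdX HX HW)) => [|s /Hz->|s /Hz->]//.
by congr (_ * _); ring.
Qed.

(** A tagged increment of [y] along the graph of [psi], compared with the
    increment of [Psi]: the mean value inequality for [psi c * y - Psi y]. *)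
Lemma antiderivative_increment psi Psi v : continuous psi ->
  (forall u, is_derive u 1 Psi (psi u)) ->
  forall e, 0 < e -> exists2 r, 0 < r & forall p q c,
    0 <= p <= v -> 0 <= q <= v -> 0 <= c <= v -> `|q - p| < r ->
    `|c - p| <= `|q - p| -> `|q - c| <= `|q - p| ->
    `|psi c * (q - p) - (Psi q - Psi p)| <= e * `|q - p|.
Proof.
move=> cpsi HPsi e e0.
have [r r0 Hr] := segment_uniform_continuity
  (continuous_subspaceT cpsi : {within `[0, v], continuous psi}) e0.
exists r => // p q c; wlog pq : p q / p <= q.
  move=> H; have [pq|/ltW qp] := leP p q; first exact: H.
  move=> hp hq hc h1 h2 h3.
  have -> : psi c * (q - p) - (Psi q - Psi p) =
    - (psi c * (p - q) - (Psi p - Psi q)) by ring.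
  rewrite (distrC q p) (distrC c p) (distrC q c) in h1 h2 h3 *.
  by rewrite normrN; exact: H.
rewrite !(ger0_norm (_ : 0 <= q - p)) ?subr_ge0//.
move=> /andP[p0 pv] /andP[q0 qv] hc qpr h1 h3.
rewrite ler_norml in h1; rewrite ler_norml in h3.
move: h1 h3 => /andP[h1 h2] /andP[h3 h4].
have -> : psi c * (q - p) - (Psi q - Psi p) =
   (psi c * q + - Psi q) - (psi c * p + - Psi p) by ring.
have HD u : is_derive u 1 (fun u => psi c * u + - Psi u) (psi c * 1 + - psi u).
  apply: is_derive_eq (derive_add (derive_mul (derive_cst (psi c) u) (derive_id u)) (derive_opp (HPsi u))) _.
  by ring.
apply: (derive_bound pq (fun u _ => HD u)) => u /andP[pu uq].
rewrite mulr1; apply/ltW/Hr => //; first by rewrite (le_trans p0)// (le_trans uq).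
by rewrite ltr_norml; apply/andP; split; lra.
Qed.

(** The chain rule [x dy = d (Psi y)] holds along the graph [x = psi y] although
    [y] need not be differentiable, and [y dx] follows by parts. *)
Lemma curve_area_graph (z : R -> plane R) psi Psi v a b : a <= b ->
  continuous psi -> (forall u, is_derive u 1 Psi (psi u)) ->
  monotone_on psi 0 v ->
  {within `[a, b], continuous (fun s => (z s).2)} ->
  monotone_on (fun s => (z s).2) a b ->
  (forall s, a <= s <= b -> 0 <= (z s).2 <= v /\ (z s).1 = psi (z s).2) ->
  curve_area z a b = Psi (z b).2 - Psi (z a).2
     - 2^-1 * ((z b).1 * (z b).2 - (z a).1 * (z a).2).
Proof.
move=> ab cpsi HPsi mpsi cy my Hz.
have Hx s : a <= s <= b -> (z s).1 = psi (z s).2 by move=> /Hz[].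
have Hy s : a <= s <= b -> 0 <= (z s).2 <= v by move=> /Hz[].
have mx := monotone_on_comp my mpsi Hy.
have [m1 Hm1] := monotone_on_modulus my.
have [m2 Hm2] := monotone_on_modulus mx.
have key e : 0 < e -> exists2 d : R, 0 < d & forall s x t,
    a <= s -> s <= x -> x <= t -> t <= b -> t - s < d ->
    `|psi (z x).2 * ((z t).2 - (z s).2) - (Psi (z t).2 - Psi (z s).2)|
      <= e * (m1 t - m1 s).
  move=> e0; have [r r0 Hr] := antiderivative_increment v cpsi HPsi e0.
  have [d d0 Hd] := segment_uniform_continuity cy r0.
  exists d => // s x t sa sx xt tb ts.
  have st : s <= t by exact: le_trans xt.
  have [B1 B2] := monotone_on_between my sa sx xt tb.
  apply: (@le_trans _ _ (e * `|(z t).2 - (z s).2|)); last by rewrite ler_pM2l// Hm1.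
  have sab : a <= s <= b by rewrite sa (le_trans st).
  have tab : a <= t <= b by rewrite tb (le_trans sa).
  apply: Hr => //; try (by apply: Hy; rewrite ?sab ?tab ?(le_trans sa) ?(le_trans xt)).
  by apply: Hd => //; rewrite ger0_norm ?subr_ge0.
rewrite /curve_area.
have -> : stieltjes (fun t => (z t).1) (fun t => (z t).2) a b =
    Psi (z b).2 - Psi (z a).2.
  apply: stieltjes_eq => //.
  apply: (@is_stieltjes_of_increments _ _ _ (fun s => Psi (z s).2) m1) => // e /key[d d0 H].
  exists d => // s x t sa sx xt tb ts; rewrite Hx; first exact: H.
  by rewrite (le_trans sa)// (le_trans xt).
have -> : stieltjes (fun t => (z t).2) (fun t => (z t).1) a b =
    ((z b).1 * (z b).2 - Psi (z b).2) - ((z a).1 * (z a).2 - Psi (z a).2).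
  apply: stieltjes_eq => //.
  apply: (@is_stieltjes_of_increments _ _ _ (fun s => (z s).1 * (z s).2 - Psi (z s).2)
    (fun s => m1 s + m2 s)) => // e e0.
  have [d d0 H] := key _ e0.
  have [d' d'0 H'] := segment_uniform_continuity cy e0.
  exists (Num.min d d') => [|s x t sa sx xt tb]; first by rewrite lt_min d0.
  rewrite lt_min => /andP[ts ts'].
  have st : s <= t by exact: le_trans xt.
  have sab : a <= s <= b by rewrite sa (le_trans st).
  have tab : a <= t <= b by rewrite tb (le_trans sa).
  have xab : a <= x <= b by rewrite (le_trans sa)// (le_trans xt).
  rewrite !Hx//.
  have -> : (z x).2 * (psi (z t).2 - psi (z s).2)
     - (psi (z t).2 * (z t).2 - Psi (z t).2 - (psi (z s).2 * (z s).2 - Psi (z s).2))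
     = ((z x).2 - (z s).2) * (psi (z t).2 - psi (z s).2)
       - (psi (z t).2 * ((z t).2 - (z s).2) - (Psi (z t).2 - Psi (z s).2)) by ring.
  apply: le_trans (ler_normB _ _) _.
  have -> : e * (m1 t + m2 t - (m1 s + m2 s)) = e * (m2 t - m2 s) + e * (m1 t - m1 s) by ring.
  apply: lerD; last by apply: H.
  rewrite normrM; apply: ler_pM => //; last exact: Hm2.
  by apply/ltW/H' => //; rewrite ger0_norm ?subr_ge0//; lra.
by field.
Qed.

(** Any parametrization of a graph has an injective, hence monotone, second
    coordinate, so all of them have the same area; the affine one shows that
    there is one. *)
Lemma arc_area_graph psi Psi v : 0 <= v ->
  continuous psi -> (forall u, is_derive u 1 Psi (psi u)) ->
  monotone_on psi 0 v ->
  let p y : plane R := (psi y, y) in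
  let A := Psi v - Psi 0 - 2^-1 * (psi v * v) in
  arc_area (p @` `[0, v]%classic) (p 0) (p v) = A /\
  arc_area (p @` `[0, v]%classic) (p v) (p 0) = - A.
Proof.
move=> v0 cpsi HPsi mpsi p A.
have unique z a b p0 p1 : parametrizes (p @` `[0, v]%classic) p0 p1 z a b ->
    curve_area z a b = Psi p1.2 - Psi p0.2 - 2^-1 * (p1.1 * p1.2 - p0.1 * p0.2).
  case=> ab cz _ iz [za zb zC].
  have Hz s : a <= s <= b -> 0 <= (z s).2 <= v /\ (z s).1 = psi (z s).2.
    move=> sab.
    have : (z @` `[a, b]%classic) (z s) by exists s => //=; rewrite in_itv.
    by rewrite zC => -[y /=]; rewrite in_itv /= => yv <-.
  have cz2 : {within `[a, b], continuous (fun s => (z s).2)}.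
    by move=> s; apply: (@cvg_comp _ _ _ z (fun q => q.2) _ _ _ (cz s)); exact: cvg_snd.
  have iz2 : {in `[a, b] &, injective (fun s => (z s).2)}.
    move=> s t sab tab st; apply: iz => //.
    move: (sab) (tab); rewrite !in_itv /= => /Hz[_ E1] /Hz[_ E2].
    by rewrite [z s]surjective_pairing [z t]surjective_pairing E1 E2 st.
  rewrite (curve_area_graph ab cpsi HPsi mpsi cz2 _ Hz) ?za ?zb//.
  have [H|H] := itv_continuous_inj_mono cz2 iz2; [left|right] => s t sa st tb.
  - by have := le_mono_in H; move=> ->; rewrite ?in_itv /= ?sa ?tb ?(le_trans sa) ?(le_trans st).
  - by have := le_nmono_in H; move=> ->; rewrite ?in_itv /= ?sa ?tb ?(le_trans sa) ?(le_trans st).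
have main (w : R -> R) p0 p1 : (forall s, 0 <= s <= v -> 0 <= w s <= v) ->
    continuous w -> injective w -> monotone_on w 0 v ->
    w @` `[0, v]%classic = `[0, v]%classic -> p (w 0) = p0 -> p (w v) = p1 ->
    arc_area (p @` `[0, v]%classic) p0 p1 =
      Psi p1.2 - Psi p0.2 - 2^-1 * (p1.1 * p1.2 - p0.1 * p0.2).
  move=> wr cw iw mw wv w0 w1.
  have [z [a [b [Hz ->]]]] : exists z a b, parametrizes (p @` `[0, v]%classic) p0 p1 z a b
      /\ arc_area (p @` `[0, v]%classic) p0 p1 = curve_area z a b.
    apply: (@xgetPex _ 0 [set A | exists z a b, parametrizes (p @` `[0, v]%classic) p0 p1 z a b
      /\ A = curve_area z a b]).
    exists (curve_area (p \o w) 0 v), (p \o w), 0, v; split => //; split => //.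
    - apply: continuous_subspaceT => s.
      have cpw : psi (w t) @[t --> s] --> psi (w s).
        exact: (@continuous_comp _ _ _ w psi s (cw s) (cpsi (w s))).
      exact: (cvg_pair cpw (cw s)).
    - split; last exact: (monotone_on_bounded_variation v0 mw).
      exact: (monotone_on_bounded_variation v0 (monotone_on_comp mw mpsi wr)).
    - by move=> s t _ _ [_ /iw].
    - by split => //; rewrite -[in RHS]wv image_comp.
  exact: unique Hz.
split.
- rewrite (main (fun s => s)) //=.
  + by rewrite /A; ring.
  + by move=> s; exact: cvg_id.
  + by left => s t.
  + by rewrite image_id.
- rewrite (main (fun s => v - s)) //=.
  + by rewrite /A; ring.
  + by move=> s /andP[s0 sv]; lra.
  + by move=> s; apply: (is_derive_continuous (derive_add (derive_cst v s) (derive_opp (derive_id s)))).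
  + by move=> s t; lra.
  + by right => s t *; lra.
  + apply/seteqP; split => s /=.
      by move=> [t /=]; rewrite !in_itv /= => ? <-; lra.
    by rewrite in_itv /= => sv; exists (v - s); rewrite ?in_itv /=; lra.
  + by rewrite subr0.
  + by rewrite subrr.
Qed.

End curve_areas.

(** * Convex bodies, supporting lines and edges *)

Section bodies.
Context {R : realType}.
Implicit Types (p q : plane R) (K X : set (plane R)) (t l c : R).

(** Convexity by real coefficients, instead of the bundled coefficients of
    [convex_set]. *)
Record body K : Prop := Body {
  body_nonempty : K !=set0;
  body_compact : compact K;
  body_convex : forall p q l, 0 <= l <= 1 -> K p -> K q ->
    K ((1 - l) *: p + l *: q)
}.

Lemma convex_body_body K : convex_body K -> body K.
Proof.
case=> K0 cK vK; split=> // p q l /andP[l0 l1] Kp Kq.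
have := vK q p (Itv01 l0 l1); rewrite !inE => /(_ Kq Kp).
by rewrite /conv /= addrC.
Qed.

Lemma dotDl p q (u : plane R) : dot (p + q) u = dot p u + dot q u.
Proof. by rewrite /dot /=; ring. Qed.

Lemma dotZl c p (u : plane R) : dot (c *: p) u = c * dot p u.
Proof. by rewrite /dot /= /GRing.scale /=; ring. Qed.

Lemma dot_comb l p q (u : plane R) :
  dot ((1 - l) *: p + l *: q) u = (1 - l) * dot p u + l * dot q u.
Proof. by rewrite dotDl !dotZl. Qed.

Lemma comb_snd l p q : ((1 - l) *: p + l *: q).2 = (1 - l) * p.2 + l * q.2.
Proof. by []. Qed.

Lemma comb_fst l p q : ((1 - l) *: p + l *: q).1 = (1 - l) * p.1 + l * q.1.
Proof. by []. Qed.

Lemma dot_continuous (u : plane R) : continuous (fun p => dot p u).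
Proof.
move=> p; apply: (@cvgD _ _ _ _ _ (fun p : plane R => p.1 * u.1) (fun p : plane R => p.2 * u.2)).
  by apply: cvgMr_tmp; exact: cvg_fst.
by apply: cvgMr_tmp; exact: cvg_snd.
Qed.

Lemma fst_continuous : continuous (fun p : plane R => p.1).
Proof. by move=> p; exact: cvg_fst. Qed.

Lemma snd_continuous : continuous (fun p : plane R => p.2).
Proof. by move=> p; exact: cvg_snd. Qed.

Lemma compact_sublevel K (f : plane R -> R) c : compact K -> continuous f ->
  compact (K `&` [set p | f p <= c]).
Proof.
move=> cK cf; apply: compact_closedI => //.
by have /continuous_closedP/(_ _ (@closed_le R c)) := cf.
Qed.

Lemma compact_argmin (K : set (plane R)) (f : plane R -> R) : K !=set0 -> compact K ->
  continuous f -> exists2 p : plane R, K p & forall q : plane R, K q -> f p <= f q.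
Proof.
move=> K0 cK cf.
have [p] := compact_EVT_min K0 cK (continuous_subspaceT cf).
rewrite inE => Kp H; exists p => // q Kq; apply: H; rewrite inE; exact: Kq.
Qed.

Lemma support_exposed K t : body K ->
  exists2 p, edge K t p & forall q, K q -> dot q (uvec t) <= support K t.
Proof.
move=> [K0 cK _].
have cf : continuous (fun p : plane R => - dot p (uvec t)).
  by move=> p; apply: cvgN; exact: dot_continuous.
have [p Kp Hp] := compact_argmin K0 cK cf.
have ub : ubound ((fun q : plane R => dot q (uvec t)) @` K) (dot p (uvec t)).
  by move=> _ [q Kq <-]; rewrite -lerN2; exact: Hp.
have E : support K t = dot p (uvec t).
  apply/eqP; rewrite eq_le; apply/andP; split.
    by apply: ge_sup => //; exists (dot p (uvec t)), p.
  by apply: ub_le_sup; [exists (dot p (uvec t))|exists p].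
by exists p; [split|move=> q Kq; rewrite E; apply: ub; exists q].
Qed.

Lemma dot_le_support K t p : body K -> K p -> dot p (uvec t) <= support K t.
Proof. by move=> /(support_exposed t)[_ _]; apply. Qed.

Lemma support_eq K t p : body K -> K p ->
  (forall q, K q -> dot q (uvec t) <= dot p (uvec t)) ->
  support K t = dot p (uvec t).
Proof.
move=> bK Kp H; apply/eqP; rewrite eq_le dot_le_support// andbT.
by have [q [Kq <-] _] := support_exposed t bK; exact: H.
Qed.

Lemma body_minkowski l K1 K2 : 0 <= l <= 1 -> body K1 -> body K2 ->
  body (minkowski_comb l K1 K2).
Proof.
move=> l01 b1 b2; split.
- have [p1 h1] := body_nonempty b1; have [p2 h2] := body_nonempty b2.
  by exists ((1 - l) *: p1 + l *: p2), p1 => //; exists p2.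
- have -> : minkowski_comb l K1 K2 =
     (fun pq : plane R * plane R => (1 - l) *: pq.1 + l *: pq.2) @` (K1 `*` K2).
    apply/seteqP; split=> p.
      by move=> [p1 h1 [p2 h2 <-]]; exists (p1, p2).
    by move=> [[p1 p2] [/= h1 h2] <-]; exists p1 => //; exists p2.
  apply: continuous_compact; last first.
    by apply: compact_setX; [exact: body_compact b1|exact: body_compact b2].
  apply: continuous_subspaceT => pq.
  apply: (@cvgD _ _ _ _ _ (fun pq : plane R * plane R => (1 - l) *: pq.1) (fun pq => l *: pq.2)).
    by apply: cvgZl_tmp; exact: cvg_fst.
  by apply: cvgZl_tmp; exact: cvg_snd.
- move=> _ _ k k01 [p1 h1 [p2 h2 <-]] [q1 g1 [q2 g2 <-]].
  exists ((1 - k) *: p1 + k *: q1); first exact: (body_convex b1).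
  exists ((1 - k) *: p2 + k *: q2); first exact: (body_convex b2).
  rewrite !scalerDr !scalerA ![l * _]mulrC ![(1 - l) * _]mulrC -!addrA.
  by congr (_ + _); rewrite addrCA.
Qed.

Lemma support_minkowski l K1 K2 t : 0 <= l <= 1 -> body K1 -> body K2 ->
  support (minkowski_comb l K1 K2) t = (1 - l) * support K1 t + l * support K2 t.
Proof.
move=> l01 b1 b2; have /andP[l0 l1] := l01.
have [p1 [h1 e1] m1] := support_exposed t b1.
have [p2 [h2 e2] m2] := support_exposed t b2.
rewrite -e1 -e2 -dot_comb; apply: support_eq; first exact: body_minkowski.
  by exists p1 => //; exists p2.
move=> _ [q1 g1 [q2 g2 <-]]; rewrite !dot_comb e1 e2.
by apply: lerD; apply: ler_wpM2l => //; [lra|exact: m1|exact: m2].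
Qed.

Lemma edge_argmin K t (f : plane R -> R) : body K -> continuous f ->
  exists p, edge K t p /\ forall q, edge K t q -> f p <= f q.
Proof.
move=> bK cf; have [p0 E0 m0] := support_exposed t bK.
have cu : continuous (fun p : plane R => - dot p (uvec t)).
  by move=> p; apply: cvgN; exact: dot_continuous.
have cE := @compact_sublevel K _ (- support K t) (body_compact bK) cu.
have edgeE p : (K `&` [set p | - dot p (uvec t) <= - support K t]) p <-> edge K t p.
  split=> -[Kp /=]; last by move=> h; split => //=; rewrite h.
  by rewrite lerN2 => h; split => //; apply/eqP; rewrite eq_le h m0.
have [|p /edgeE Ep Hp] := compact_argmin _ cE cf; first by exists p0; apply/edgeE.
by exists p; split => // q /edgeE /Hp.
Qed.

Lemma vplus_edge K t : body K -> edge K t (vplus K t) /\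
  forall q, edge K t q -> dot q (vvec t) <= dot (vplus K t) (vvec t).
Proof.
move=> bK; have cv : continuous (fun p : plane R => - dot p (vvec t)).
  by move=> p; apply: cvgN; exact: dot_continuous.
have [p [Ep Hp]] := edge_argmin t bK cv.
apply: (@xgetPex _ 0 [set p | edge K t p /\
  forall q, edge K t q -> dot q (vvec t) <= dot p (vvec t)]).
by exists p; split => // q /Hp; rewrite lerN2.
Qed.

Lemma vminus_edge K t : body K -> edge K t (vminus K t) /\
  forall q, edge K t q -> dot (vminus K t) (vvec t) <= dot q (vvec t).
Proof.
move=> bK; have [p Hp] := edge_argmin t bK (@dot_continuous (vvec t)).
by apply: (@xgetPex _ 0 [set p | edge K t p /\
  forall q, edge K t q -> dot p (vvec t) <= dot q (vvec t)]); exists p.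
Qed.

End bodies.

(** * The convex profile of a body touching the axis *)

Section profile.
Context {R : realType}.
Implicit Types (p q X Z : plane R) (B : set (plane R)) (y s t l d phi : R).

(** Taking all heights up to [y], and not only [y], replaces [B] by its sum
    with the ray spanned by [vvec phi], along which [dot p (uvec phi)] is
    constant. The profile is then defined at all heights, whatever the extent
    of [B], and constant above the point of [B] where it is least. *)
Definition profile B phi y : R :=
  inf [set dot p (uvec phi) | p in B `&` [set p | p.2 <= y]].

Record grounded B : Prop := Grounded {
  grounded_body : body B;
  grounded_ge0 : forall p, B p -> 0 <= p.2;
  grounded_touch : exists2 p, B p & p.2 = 0
}.

Variables (B : set (plane R)) (phi : R).
Hypothesis gB : grounded B.

Let bB := grounded_body gB.

Lemma profile_attained y : 0 <= y ->
  exists p, [/\ B p, p.2 <= y, dot p (uvec phi) = profile B phi y &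
   forall q, B q -> q.2 <= y -> profile B phi y <= dot q (uvec phi)].
Proof.
move=> y0.
have cS := @compact_sublevel _ B (fun p => p.2) y (body_compact bB) snd_continuous.
have [|p [Bp py] Hp] := compact_argmin _ cS (@dot_continuous _ (uvec phi)).
  by have [p Bp p0] := grounded_touch gB; exists p; split => //=; rewrite p0.
have lb : lbound ((fun q : plane R => dot q (uvec phi)) @` (B `&` [set p | p.2 <= y]))
    (dot p (uvec phi)) by move=> _ [q Bq <-]; exact: Hp.
have E : profile B phi y = dot p (uvec phi).
  apply/eqP; rewrite eq_le; apply/andP; split.
    by apply: ge_inf; [exists (dot p (uvec phi))|exists p].
  by apply: lb_le_inf => //; exists (dot p (uvec phi)), p.
exists p; split => // q Bq qy; rewrite E; apply: Hp; by split.
Qed.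

Lemma profile_le q y : 0 <= y -> B q -> q.2 <= y ->
  profile B phi y <= dot q (uvec phi).
Proof. by move=> /profile_attained[p [_ _ _ H]]; exact: H. Qed.

Lemma profile_nonincreasing s t : 0 <= s -> s <= t ->
  profile B phi t <= profile B phi s.
Proof.
move=> s0 st; have [p [Bp ps <- _]] := profile_attained s0.
by apply: profile_le => //; [exact: le_trans st|exact: le_trans st].
Qed.

Lemma profile_convex s t l : 0 <= s -> 0 <= t -> 0 <= l <= 1 ->
  profile B phi ((1 - l) * s + l * t) <=
    (1 - l) * profile B phi s + l * profile B phi t.
Proof.
move=> s0 t0 l01; have /andP[l0 l1] := l01.
have l1' : 0 <= 1 - l by lra.
have [p [Bp ps <- _]] := profile_attained s0.
have [q [Bq qt <- _]] := profile_attained t0.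
rewrite -dot_comb; apply: profile_le.
- by rewrite addr_ge0// mulr_ge0.
- exact: body_convex.
- by rewrite comb_snd lerD// ler_wpM2l.
Qed.

(** Convexity without a quotient, for three ordered heights. *)
Lemma profile_chord r s t : 0 <= r -> r <= s -> s <= t ->
  (t - r) * profile B phi s <=
    (t - s) * profile B phi r + (s - r) * profile B phi t.
Proof.
move=> r0 rs st; have [tr|] := eqVneq t r.
  have sr : s = r by apply/eqP; rewrite eq_le rs -tr st.
  by rewrite tr sr !subrr !mul0r addr0.
rewrite -subr_eq0 => tr.
have tr0 : 0 < t - r by rewrite lt_neqAle eq_sym tr subr_ge0 (le_trans rs).
have l01 : 0 <= (s - r) / (t - r) <= 1.
  by rewrite divr_ge0 ?subr_ge0//= ?(le_trans rs)// ler_pdivrMr// mul1r lerD2r.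
have t0 : 0 <= t by lra.
have := profile_convex r0 t0 l01.
have -> : (1 - (s - r) / (t - r)) * r + (s - r) / (t - r) * t = s by field.
rewrite -(ler_pM2l tr0) => /le_trans; apply.
by rewrite le_eqVlt; apply/orP; left; apply/eqP; field.
Qed.

(** A point of [B] with [dot p (uvec phi) <= profile B phi 0 - e] has positive
    height, and by compactness such heights are bounded below. *)
Lemma profile_right_continuous0 e : 0 < e -> exists2 d : R, 0 < d &
  forall y, 0 <= y -> y < d -> profile B phi 0 - profile B phi y < e.
Proof.
move=> e0.
have cS := @compact_sublevel _ B (fun p => dot p (uvec phi)) (profile B phi 0 - e)
   (body_compact bB) (@dot_continuous _ (uvec phi)).
have [[p0 Sp0]|S0] := pselect ((B `&` [set p | dot p (uvec phi) <= profile B phi 0 - e]) !=set0); last first.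
  exists 1 => // y y0 _; rewrite ltNge; apply/negP => H.
  have [p [Bp py E _]] := profile_attained y0.
  by apply: S0; exists p; split => //=; rewrite E; lra.
have [|p [Bp /= pw] Hp] := compact_argmin _ cS snd_continuous; first by exists p0.
have p20 : 0 < p.2.
  rewrite ltNge; apply/negP => p20.
  by have := profile_le (lexx 0) Bp p20; lra.
exists p.2 => // y y0 yp; rewrite ltNge; apply/negP => H.
have [q [Bq qy E _]] := profile_attained y0.
have : p.2 <= q.2 by apply: Hp; split => //=; rewrite E; lra.
by lra.
Qed.

(** By convexity the profile is nowhere steeper than at [0], so continuity at
    [0] controls it everywhere. *)
Lemma profile_modulus s t : 0 <= s -> s <= t ->
  profile B phi s - profile B phi t <= profile B phi 0 - profile B phi (t - s).
Proof.
move=> s0 st; have [t0|/ltW] := leP t 0.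
  have [-> ->] : s = 0 /\ t = 0 by split; apply/eqP; rewrite eq_le; apply/andP; split; lra.
  by rewrite !subrr.
rewrite le_eqVlt => /predU1P[t0|t0].
  have -> : s = 0 by apply/eqP; rewrite eq_le s0 andbT t0.
  by rewrite -t0 !subrr.
have h1 := profile_chord (lexx 0) s0 st.
have h2 : (t - 0) * profile B phi (t - s) <=
    (t - (t - s)) * profile B phi 0 + (t - s - 0) * profile B phi t.
  by apply: profile_chord; lra.
by rewrite -(ler_pM2l t0); lra.
Qed.

Lemma profile_max_continuous : continuous (fun y => profile B phi (Num.max 0 y)).
Proof.
move=> x; apply/cvgrPdist_lt => e /profile_right_continuous0[d d0 Hd].
exists d => //= y /=; rewrite /ball_ /= => xy.
have main s t : s <= t -> t - s < d ->
   `|profile B phi (Num.max 0 s) - profile B phi (Num.max 0 t)| < e.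
  move=> st ts.
  have m0 u : 0 <= Num.max 0 u :> R by rewrite le_max lexx.
  have st' : Num.max 0 s <= Num.max 0 t.
    by rewrite ge_max m0 /= le_max st orbT.
  rewrite ger0_norm ?subr_ge0; last exact: profile_nonincreasing.
  apply: le_lt_trans (profile_modulus (m0 s) st') _.
  apply: Hd; first by rewrite subr_ge0.
  by apply: le_lt_trans ts; rewrite /Num.max; case: (ltP 0 s); case: (ltP 0 t); lra.
have [xy'|/ltW yx] := leP x y.
  by apply: main => //; move: xy; rewrite ltr_norml => /andP[? ?]; lra.
rewrite distrC; apply: main => //.
by move: xy; rewrite ltr_norml => /andP[? ?]; lra.
Qed.

End profile.

(** * The lower boundary arc as a graph *)

Section lower_arc.
Context {R : realType}.
Implicit Types (p q : plane R) (y s t : R).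

(** The edge of [B] with outer normal [- uvec t]: for [t] between
    [phi] and [pi / 2] these edges make up the arc of [B]. *)
Definition lowest (B : set (plane R)) t : set (plane R) :=
  [set p | B p /\ forall q, B q -> dot p (uvec t) <= dot q (uvec t)].

Variables (B : set (plane R)) (phi : R) (X Z : plane R).
Hypothesis gB : grounded B.
Hypothesis phi_range : 0 < phi < pi / 2.
Hypothesis lowX : lowest B phi X.
Hypothesis botX : forall q, lowest B phi q -> X.2 <= q.2.
Hypothesis BZ : B Z.
Hypothesis Z0 : Z.2 = 0.
Hypothesis leftZ : forall q, B q -> q.2 = 0 -> Z.1 <= q.1.

Let m := profile B phi.

(** The abscissa of the point of height [y] on the line where
    [dot p (uvec phi)] is the value of the profile. The maximum extends the
    graph to a continuous function on the line. *)
Definition arc_abscissa y : R :=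
  (profile B phi (Num.max 0 y) - y * sin phi) / cos phi.

Let sphi : 0 < sin phi.
Proof.
by apply: sin_gt0_pihalf.
Qed.

Let cphi : 0 < cos phi.
Proof. by apply: cos_gt0_pihalf; have /andP[? ?] := phi_range; lra. Qed.

Let BX : B X := proj1 lowX.

Let minX : forall q, B q -> dot X (uvec phi) <= dot q (uvec phi) := proj2 lowX.

Let X0 : 0 <= X.2 := grounded_ge0 gB BX.

Lemma profile_stationary y : X.2 <= y -> m y = dot X (uvec phi).
Proof.
move=> Xy; have y0 := le_trans X0 Xy.
apply/eqP; rewrite eq_le profile_le//=.
by rewrite /m; have [p [Bp _ <- _]] := profile_attained phi gB y0; exact: minX.
Qed.

Lemma profile_decreasing_before y : 0 <= y -> y < X.2 -> dot X (uvec phi) < m y.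
Proof.
move=> y0 yX; have [p [Bp py E _]] := profile_attained phi gB y0.
rewrite /m -E lt_neqAle minX// andbT; apply/eqP => Ep.
have : X.2 <= p.2 by apply: botX; split => // q Bq; rewrite -Ep minX.
by lra.
Qed.

Lemma profile_bottom : m 0 = dot Z (uvec phi).
Proof.
apply/eqP; rewrite eq_le profile_le//= ?Z0//.
have [p [Bp p0 E _]] := profile_attained phi gB (lexx 0).
have pe : p.2 = 0 by apply/eqP; rewrite eq_le p0 (grounded_ge0 gB Bp).
rewrite /m -E /dot pe Z0 !mul0r !addr0 ler_wpM2r//; first exact: ltW.
exact: leftZ.
Qed.

Lemma fst_of_profile p : 0 <= p.2 -> dot p (uvec phi) = m p.2 ->
  p.1 = arc_abscissa p.2.
Proof.
move=> p0; rewrite /arc_abscissa (max_idPr p0) -/m => <-.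
by rewrite /dot /uvec /=; field; rewrite gt_eqF.
Qed.

Lemma arc_abscissa_top : arc_abscissa X.2 = X.1.
Proof. by rewrite -fst_of_profile// profile_stationary. Qed.

Lemma arc_abscissa_bottom : arc_abscissa 0 = Z.1.
Proof. by rewrite -Z0 -fst_of_profile// Z0// profile_bottom. Qed.

(** Rotating the normal from [phi] towards [pi / 2] amounts to adding a
    positive multiple of the height. *)
Lemma dot_uvec_slope t q : cos t != 0 ->
  dot q (uvec t) = cos t / cos phi *
    (dot q (uvec phi) + sin (t - phi) / cos t * q.2).
Proof.
move=> ct; rewrite /dot /uvec /= sinB.
have c0 : cos phi != 0 by rewrite gt_eqF.
move: (cos t) (sin t) (cos phi) (sin phi) (q.1) (q.2) ct c0 => a b c d x y a0 c0.
by field; rewrite a0 c0.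
Qed.

(** A minimizer of [dot p (uvec phi) + mu * p.2] with [mu > 0] also minimizes
    [dot p (uvec phi)] among the points that are not higher. *)
Lemma lowest_on_graph t p : phi < t < pi / 2 -> lowest B t p ->
  p.2 <= X.2 /\ p.1 = arc_abscissa p.2.
Proof.
move=> /andP[pt t2] [Bp Hp].
have /andP[p0 _] := phi_range.
have ct : 0 < cos t by apply: cos_gt0_pihalf; lra.
have st : 0 < sin (t - phi) by apply: sin_gt0_pihalf; lra.
pose mu := sin (t - phi) / cos t.
have mu0 : 0 < mu by rewrite divr_gt0.
have {}Hp q : B q -> dot p (uvec phi) + mu * p.2 <= dot q (uvec phi) + mu * q.2.
  move=> /Hp; rewrite !(@dot_uvec_slope t) ?gt_eqF//.
  by rewrite ler_pM2l// divr_gt0.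
clearbody mu.
split.
  have h1 := Hp _ BX; have h2 := minX Bp.
  by rewrite -(ler_pM2l mu0); lra.
have p20 := grounded_ge0 gB Bp.
apply: fst_of_profile => //.
apply/eqP; rewrite eq_le; apply/andP; split; last by rewrite /m profile_le.
rewrite /m; have [q [Bq qy <- _]] := profile_attained phi gB p20.
have h := Hp _ Bq.
have : mu * q.2 <= mu * p.2 by rewrite ler_pM2l.
by lra.
Qed.

(** The slope is the least upper bound of the slopes of the chords to the right
    of [y]. It is not zero, because the profile decreases until the height of
    [X]. *)
Lemma profile_subgradient y : 0 < y -> y < X.2 ->
  exists2 mu, 0 < mu & forall s, 0 <= s -> m y - mu * (s - y) <= m s.
Proof.
move=> y0 yX.
pose S := [set (m y - m s) / (s - y) | s in [set s | y < s]].
have ubS r : 0 <= r -> r < y -> ubound S ((m r - m y) / (y - r)).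
  move=> r0 ry _ [s /= ys <-].
  rewrite ler_pdivrMr ?subr_gt0// mulrAC ler_pdivlMr ?subr_gt0//.
  have := profile_chord phi gB r0 (ltW ry) (ltW ys); rewrite -!/(m _).
  by lra.
have SX : S ((m y - m X.2) / (X.2 - y)) by exists X.2.
have S0 : S !=set0 by exists ((m y - m X.2) / (X.2 - y)).
have hS : has_ubound S by exists ((m 0 - m y) / (y - 0)); exact: ubS.
exists (sup S).
  apply: lt_le_trans (ub_le_sup hS SX).
  rewrite divr_gt0 ?subr_gt0// profile_stationary//.
  by apply: profile_decreasing_before => //; exact: ltW.
move=> s s0; have [sy|ys|->] := ltrgtP s y; last by rewrite subrr mulr0 subr0.
- have : sup S <= (m s - m y) / (y - s) by apply: ge_sup => //; exact: ubS.
  by rewrite ler_pdivlMr ?subr_gt0//; lra.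
- have : (m y - m s) / (s - y) <= sup S by apply: ub_le_sup => //; exists s.
  by rewrite ler_pdivrMr ?subr_gt0//; lra.
Qed.

(** A supporting line of the profile at [y] supports [B] at the minimizer of
    height [y]; its slope gives the normal. *)
Lemma graph_is_lowest y : 0 < y -> y < X.2 ->
  exists2 t, phi < t < pi / 2 & lowest B t (arc_abscissa y, y).
Proof.
move=> y0 yX.
have [p [Bp py E _]] := profile_attained phi gB (ltW y0).
have p20 := grounded_ge0 gB Bp.
(* a minimizer strictly below height [y] would make the profile flat at [y] *)
have p2y : p.2 = y.
  apply/eqP; rewrite eq_le py /= leNgt; apply/negP => p2y.
  have h1 := profile_chord phi gB p20 (ltW p2y) (ltW yX).
  have h2 := profile_le phi gB p20 Bp (lexx _).
  have h3 := profile_decreasing_before (ltW y0) yX.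
  have h4 := profile_stationary (lexx X.2).
  rewrite -!/(m _) in h1 h2 E; rewrite h4 in h1; rewrite E in h2.
  have h5 : (X.2 - y) * m p.2 <= (X.2 - y) * m y by rewrite ler_pM2l// subr_gt0.
  have h6 : (y - p.2) * dot X (uvec phi) < (y - p.2) * m y by rewrite ltr_pM2l// subr_gt0.
  by lra.
have -> : (arc_abscissa y, y) = p.
  by rewrite [RHS]surjective_pairing p2y (fst_of_profile p20) ?p2y.
have [mu mu0 Hmu] := profile_subgradient y0 yX.
have Hp q : B q -> dot p (uvec phi) + mu * p.2 <= dot q (uvec phi) + mu * q.2.
  move=> Bq; have q20 := grounded_ge0 gB Bq.
  have h1 := profile_le phi gB q20 Bq (lexx _).
  have h2 := Hmu _ q20.
  by rewrite -!/(m _) in h1 h2 E; rewrite p2y; lra.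
have /andP[p0 p2] := phi_range.
pose t := atan (tan phi + mu / cos phi).
have t2 : t < pi / 2 by exact: atan_ltpi2.
have tt : tan t = tan phi + mu / cos phi by rewrite atanK.
have pt : phi < t.
  rewrite -[phi]tanK; last by rewrite in_itv /=; lra.
  by apply: lt_atan; rewrite ltrDl divr_gt0.
have ct : 0 < cos t by apply: cos_gt0_pihalf; lra.
exists t; first by rewrite pt.
have slope : sin (t - phi) / cos t = mu.
  rewrite sinB mulrBl mulrAC -/(tan t) tt [cos t * _]mulrC mulfK ?gt_eqF//.
  by rewrite /tan; field; rewrite gt_eqF.
split => // q Bq; rewrite !(@dot_uvec_slope t) ?gt_eqF// slope.
by rewrite ler_pM2l ?divr_gt0// Hp.
Qed.

Lemma lower_arc_graph :
  [set X] `|` \bigcup_(t in `]phi, (pi / 2)[%classic) lowest B t `|` [set Z] =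
  (fun y => (arc_abscissa y, y)) @` `[0, X.2]%classic.
Proof.
apply/seteqP; split => [p|_ [y /= + <-]].
  move=> [[->|[t /=]]|->].
  - by exists X.2; rewrite /= ?in_itv /= ?X0 ?lexx// arc_abscissa_top -surjective_pairing.
  - rewrite in_itv /= => tr lp; have [h1 h2] := lowest_on_graph tr lp.
    exists p.2; last by rewrite -h2 -surjective_pairing.
    by rewrite /= in_itv /= h1 (grounded_ge0 gB (proj1 lp)).
  - exists 0; first by rewrite /= in_itv /= X0 lexx.
    by rewrite arc_abscissa_bottom -Z0 -surjective_pairing.
rewrite in_itv /= => /andP[]; rewrite le_eqVlt => /predU1P[<- _|y0].
  by right; rewrite arc_abscissa_bottom -Z0 -surjective_pairing.
rewrite le_eqVlt => /predU1P[->|yX].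
  by left; left; rewrite arc_abscissa_top -surjective_pairing.
have [t tr lt] := graph_is_lowest y0 yX.
by left; right; exists t => //=; rewrite in_itv.
Qed.

End lower_arc.

(** * Mirror images, and the area of a lower arc *)

Section arc_values.
Context {R : realType}.
Implicit Types (p q : plane R) (B D K : set (plane R)) (y s t l phi : R).

Definition refl p : plane R := (- p.1, p.2).

Lemma reflK p : refl (refl p) = p.
Proof. by rewrite /refl /= opprK -surjective_pairing. Qed.

Lemma refl_comb l p q :
  refl ((1 - l) *: p + l *: q) = (1 - l) *: refl p + l *: refl q.
Proof.
apply: injective_projections; last by [].
change (- ((1 - l) * p.1 + l * q.1) = (1 - l) * - p.1 + l * - q.1).
by ring.
Qed.

Lemma refl_image_iff K p : (refl @` K) (refl p) <-> K p.
Proof.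
split=> [[q Kq /(congr1 refl)]|Kp]; last by exists p.
by rewrite !reflK => <-.
Qed.

Lemma body_refl K : body K -> body (refl @` K).
Proof.
move=> bK; split.
- by have [p Kp] := body_nonempty bK; exists (refl p), p.
- apply: continuous_compact; last exact: body_compact bK.
  apply: continuous_subspaceT => p.
  have c1 : - q.1 @[q --> p] --> - p.1 by apply: cvgN; exact: fst_continuous.
  exact: cvg_pair c1 (@snd_continuous _ p).
- move=> _ _ l l01 [p Kp <-] [q Kq <-]; exists ((1 - l) *: p + l *: q).
    exact: body_convex.
  exact: refl_comb.
Qed.

Lemma minkowski_refl l B D :
  minkowski_comb l (refl @` B) (refl @` D) = refl @` minkowski_comb l B D.
Proof.
have E p q : (1 - l) *: refl p + l *: refl q = refl ((1 - l) *: p + l *: q).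
  by rewrite refl_comb.
apply/seteqP; split=> [_ [_ [p Bp <-] [_ [q Dq <-] <-]]|_ [_ [p Bp [q Dq <-]] <-]].
  by exists ((1 - l) *: p + l *: q) => //; exists p => //; exists q.
by exists (refl p); [exists p|exists (refl q); [exists q|rewrite E]].
Qed.

Lemma grounded_minkowski l B D : 0 <= l <= 1 -> grounded B -> grounded D ->
  grounded (minkowski_comb l B D).
Proof.
move=> l01 gB gD; have /andP[l0 l1] := l01; split.
- by apply: body_minkowski => //; exact: grounded_body.
- move=> _ [p Bp [q Dq <-]]; rewrite comb_snd addr_ge0// mulr_ge0//.
  + by lra.
  + exact: grounded_ge0 gB _ Bp.
  + exact: grounded_ge0 gD _ Dq.
- have [p Bp p0] := grounded_touch gB; have [q Dq q0] := grounded_touch gD.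
  exists ((1 - l) *: p + l *: q); first by exists p => //; exists q.
  by rewrite comb_snd p0 q0 !mulr0 addr0.
Qed.

(** A Minkowski combination of minimizers is a competitor for the combined
    body. *)
Lemma profile_minkowski l B D phi y : 0 <= l <= 1 -> 0 <= y ->
  grounded B -> grounded D ->
  profile (minkowski_comb l B D) phi y <=
    (1 - l) * profile B phi y + l * profile D phi y.
Proof.
move=> l01 y0 gB gD; have /andP[l0 l1] := l01.
have [p [Bp py <- _]] := profile_attained phi gB y0.
have [q [Dq qy <- _]] := profile_attained phi gD y0.
rewrite -dot_comb; apply: profile_le => //; first exact: grounded_minkowski.
  by exists p => //; exists q.
have -> : y = (1 - l) * y + l * y by ring.
by rewrite comb_snd lerD// ler_wpM2l//; lra.
Qed.

(** Both sides are minus the area between the arc and its two tangent lines,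
    on the left computed with the corner of the tangent lines, on the right by
    horizontal slices. Any [T] above the contact point may be used because the
    profile is the constant [g] there, so one [T] serves several bodies. The
    mirror image has the same area because it is followed backwards. *)
Lemma lower_arc_value B phi (X Z : plane R) (gam : R) Mu T :
  grounded B -> 0 < phi < pi / 2 ->
  lowest B phi X -> (forall q, lowest B phi q -> X.2 <= q.2) ->
  B Z -> Z.2 = 0 -> (forall q, B q -> q.2 = 0 -> Z.1 <= q.1) ->
  (forall y, is_derive y 1 Mu (profile B phi (Num.max 0 y))) -> X.2 <= T ->
  let g := dot X (uvec phi) in
  let C := [set X] `|` \bigcup_(t in `]phi, (pi / 2)[%classic) lowest B t `|` [set Z] in
  let x := g *: uvec phi + gam *: vvec phi in
  segment_area x X + arc_area C X Z + 2^-1 * (g ^+ 2 * tan phi + g * gam)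
    = - ((Mu T - Mu 0 - T * g) / cos phi) /\
  arc_area (refl @` C) (refl Z) (refl X) = arc_area C X Z.
Proof.
move=> gB phir lowX botX BZ Z0 leftZ HMu XT g C x.
have /andP[phi0 phi2] := phir.
have c0 : cos phi != 0 by rewrite gt_eqF// cos_gt0_pihalf//; lra.
have s0 : 0 < sin phi by apply: sin_gt0_pihalf.
have X0 : 0 <= X.2 := grounded_ge0 gB (proj1 lowX).
have CE := lower_arc_graph gB phir lowX botX BZ Z0 leftZ.
have topE := arc_abscissa_top gB phir lowX.
have botE := arc_abscissa_bottom gB phir BZ Z0 leftZ.
pose psi := arc_abscissa B phi.
pose Psi y := (Mu y + - (sin phi * (y * y / 2))) * (cos phi)^-1.
have cpsi : continuous psi.
  move=> y; apply: (@cvgMr_tmp _ _ _ _ (fun y => profile B phi (Num.max 0 y) - y * sin phi)).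
  apply: cvgB; first exact: profile_max_continuous.
  by apply: cvgMr_tmp; exact: cvg_id.
have dPsi y : is_derive y 1 Psi (psi y).
  apply: is_derive_eq (derive_mul (derive_add (HMu y) (derive_opp (derive_mul
    (derive_cst (sin phi) y) (derive_mul (derive_mul (derive_id y) (derive_id y))
      (derive_cst 2^-1 y))))) (derive_cst (cos phi)^-1 y)) _.
  rewrite /psi /arc_abscissa.
  move: (profile _ _ _) (sin phi) (cos phi) c0 => a b c c0.
  by field.
have mpsi : monotone_on psi 0 X.2.
  right => s t s0' st tv; rewrite /psi /arc_abscissa ler_pM2r ?invr_gt0 ?cos_gt0_pihalf//; last by lra.
  have t0 : 0 <= t by exact: le_trans st.
  rewrite !max_r// lerB//; first exact: profile_nonincreasing.
  by rewrite ler_wpM2r// ltW.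
have [h1 h2] := arc_area_graph X0 cpsi dPsi mpsi.
have pX : (psi X.2, X.2) = X by rewrite /psi topE -surjective_pairing.
have pZ : (psi 0, 0) = Z by rewrite /psi botE -Z0 -surjective_pairing.
have {h2}AC : arc_area C X Z = - (Psi X.2 - Psi 0 - 2^-1 * (X.1 * X.2)).
  by move: h2; rewrite pX pZ -topE -CE.
split.
- (* beyond the contact height the profile is the constant [g] *)
  have MT : Mu T = Mu X.2 + g * (T - X.2).
    suff : Mu T + - (g * T) = Mu X.2 + - (g * X.2) by lra.
    apply: (@derive0_eq _ (fun y => Mu y + - (g * y))) => // y /andP[yX yT].
    apply: is_derive_eq (derive_add (HMu y) (derive_opp (derive_mul (derive_cst g y) (derive_id y)))) _.
    rewrite max_r; last exact: le_trans yX.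
    by rewrite (profile_stationary gB lowX)// -/g; ring.
  rewrite AC MT /Psi /segment_area /cross /x /g /dot /uvec /vvec /tan /=.
  rewrite /GRing.scale /=.
  have e2 := cos2Dsin2 phi.
  move: (Mu X.2) (Mu 0) (X.1) (X.2) (cos phi) (sin phi) c0 e2 => M M0 x1 x2 c s c0 e2.
  have s2 : s ^+ 2 = 1 - c ^+ 2 by rewrite -e2; ring.
  apply/eqP; rewrite -subr_eq0; apply/eqP.
  rewrite (_ : _ - _ = (c ^+ 2 + s ^+ 2 - 1) * (x2 * (x1 * c + x2 * s) / 2 / c)); last by field.
  by rewrite e2 subrr mul0r.
- have cpsi' : continuous (fun y => - psi y) by move=> y; apply: cvgN; exact: cpsi.
  have dPsi' y : is_derive y 1 (fun y => - Psi y) (- psi y) by exact: derive_opp.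
  have mpsi' : monotone_on (fun y => - psi y) 0 X.2.
    by case: mpsi => H; [right|left] => s t ? ? ?; rewrite lerN2; exact: H.
  have [+ _] := arc_area_graph X0 cpsi' dPsi' mpsi'.
  rewrite -[(- psi 0, 0)]/(refl (psi 0, 0)) -[(- psi X.2, X.2)]/(refl (psi X.2, X.2)) pX pZ.
  have -> : (fun y => (- psi y, y)) @` `[0, X.2]%classic = refl @` C.
    by rewrite /C CE image_comp.
  by move=> ->; rewrite AC /psi topE; lra.
Qed.

End arc_values.

(** * The arcs of the two lower bodies *)

Section niche_arcs.
Context {R : realType}.
Implicit Types (p q : plane R) (B D K : set (plane R)) (y s t l phi g gam T : R)
  (Mu : R -> R).

Lemma three_halves_pi : 3 * pi / 2 = pi + pi / 2 :> R.
Proof. by field. Qed.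

Lemma dot_uvec_piD p t : dot p (uvec (pi + t)) = - dot p (uvec t).
Proof. by rewrite /dot /uvec /= ![pi + t]addrC cosDpi sinDpi; ring. Qed.

Lemma dot_vvec_piD p t : dot p (vvec (pi + t)) = - dot p (vvec t).
Proof. by rewrite /dot /vvec /= ![pi + t]addrC cosDpi sinDpi; ring. Qed.

Lemma dot_uvec_three_halves p s :
  dot p (uvec (3 * pi / 2 + s)) = - dot (refl p) (uvec (pi / 2 - s)).
Proof.
rewrite three_halves_pi -addrA dot_uvec_piD /dot /uvec /refl /=.
by rewrite ![pi / 2 + s]addrC cosDpihalf sinDpihalf cos_pihalfB sin_pihalfB; ring.
Qed.

Lemma dot_vvec_three_halves p s :
  dot p (vvec (3 * pi / 2 + s)) = dot (refl p) (vvec (pi / 2 - s)).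
Proof.
rewrite three_halves_pi -addrA dot_vvec_piD /dot /vvec /refl /=.
by rewrite ![pi / 2 + s]addrC cosDpihalf sinDpihalf cos_pihalfB sin_pihalfB; ring.
Qed.

Lemma edge_piD B t : body B -> edge B (pi + t) = lowest B t.
Proof.
move=> bB; apply/seteqP; split => p.
- move=> [Bp E]; split => // q Bq.
  have := dot_le_support (pi + t) bB Bq.
  by rewrite -E !dot_uvec_piD lerN2.
- move=> [Bp H]; split => //; apply/esym/support_eq => // q Bq.
  by rewrite !dot_uvec_piD lerN2 H.
Qed.

Lemma edge_three_halves D s p : body D ->
  edge D (3 * pi / 2 + s) p <-> lowest (refl @` D) (pi / 2 - s) (refl p).
Proof.
move=> bD; split.
- move=> [Dp E]; split; first by exists p.
  move=> _ [q Dq <-].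
  have := dot_le_support (3 * pi / 2 + s) bD Dq.
  by rewrite -E !dot_uvec_three_halves lerN2.
- move=> [/refl_image_iff Dp H]; split => //; apply/esym/support_eq => // q Dq.
  by rewrite !dot_uvec_three_halves lerN2 H//; exists q.
Qed.

Lemma dot_uvec_pihalf p : dot p (uvec (pi / 2)) = p.2.
Proof. by rewrite /dot /uvec /= cos_pihalf sin_pihalf mulr0 mulr1 add0r. Qed.

Lemma dot_vvec_pihalf p : dot p (vvec (pi / 2)) = - p.1.
Proof. by rewrite /dot /vvec /= cos_pihalf sin_pihalf mulr0 mulrN1 addr0. Qed.

Lemma grounded_support B : body B -> support B (pi + pi / 2) = 0 -> grounded B.
Proof.
move=> bB sB; split => //.
- move=> p Bp; have := dot_le_support (pi + pi / 2) bB Bp.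
  by rewrite sB dot_uvec_piD dot_uvec_pihalf oppr_le0.
- have [p [Bp E] _] := support_exposed (pi + pi / 2) bB.
  exists p => //; move: E; rewrite sB dot_uvec_piD dot_uvec_pihalf => /eqP.
  by rewrite oppr_eq0 => /eqP.
Qed.

(** On a line of normal [uvec phi], height and [vvec phi] coordinate grow
    together. *)
Lemma snd_le_of_vvec phi p q : 0 < cos phi ->
  dot p (uvec phi) = dot q (uvec phi) -> dot p (vvec phi) <= dot q (vvec phi) ->
  p.2 <= q.2.
Proof.
move=> c0 hu hv.
have E r : r.2 = dot r (uvec phi) * sin phi + dot r (vvec phi) * cos phi.
  rewrite /dot /uvec /vvec /=.
  have e2 := cos2Dsin2 phi.
  transitivity (r.2 * (cos phi ^+ 2 + sin phi ^+ 2)); first by rewrite e2 mulr1.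
  by ring.
by rewrite (E p) (E q) hu lerD2l ler_pM2r.
Qed.

(** The support function at [pi + phi] is the opposite of the level of the
    tangent line, and [vplus] picks the lowest point on it. *)
Lemma left_arc_value B phi g gam : body B -> 0 < phi < pi / 2 ->
  support B (pi + phi) = - g -> support B (pi + pi / 2) = 0 ->
  grounded B /\ exists v, forall Mu T,
  (forall y, is_derive y 1 Mu (profile B phi (Num.max 0 y))) -> v <= T ->
  segment_area (g *: uvec phi + gam *: vvec phi) (vplus B (pi + phi))
    + boundary_arc_area B (pi + phi) (3 * pi / 2)
    + 2^-1 * (g ^+ 2 * tan phi + g * gam)
  = - ((Mu T - Mu 0 - T * g) / cos phi).
Proof.
move=> bB phir sg s0; have gB := grounded_support bB s0; split => //.
have /andP[phi0 phi2] := phir.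
have c0 : 0 < cos phi by apply: cos_gt0_pihalf; lra.
have [XE Xmax] := vplus_edge (pi + phi) bB.
have [ZE Zmin] := vminus_edge (pi + pi / 2) bB.
pose X := vplus B (pi + phi); pose Z := vminus B (pi + pi / 2).
have gX : g = dot X (uvec phi).
  by apply: oppr_inj; rewrite -sg -(proj2 XE) dot_uvec_piD.
have E2 q : B q -> q.2 = 0 <-> edge B (pi + pi / 2) q.
  move=> Bq; split=> [q0|[_]]; first by split => //; rewrite s0 dot_uvec_piD dot_uvec_pihalf q0 oppr0.
  by rewrite s0 dot_uvec_piD dot_uvec_pihalf => /eqP; rewrite oppr_eq0 => /eqP.
have BZ : B Z := proj1 ZE.
have Z0 : Z.2 = 0 by apply/E2.
have leftZ q : B q -> q.2 = 0 -> Z.1 <= q.1.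
  move=> Bq /(E2 _ Bq)/Zmin.
  by rewrite !dot_vvec_piD !dot_vvec_pihalf !opprK.
have lowX : lowest B phi X by rewrite -edge_piD.
have botX q : lowest B phi q -> X.2 <= q.2.
  move=> lq; apply: (snd_le_of_vvec c0).
    by apply/eqP; rewrite eq_le (proj2 lowX _ (proj1 lq)) (proj2 lq _ (proj1 lowX)).
  by move: lq; rewrite -edge_piD// => /Xmax; rewrite !dot_vvec_piD lerN2.
exists X.2 => Mu T HMu XT.
have [H _] := lower_arc_value gam gB phir lowX botX BZ Z0 leftZ HMu XT.
rewrite -gX in H; rewrite -H; congr (_ + _ + _).
rewrite /boundary_arc_area /boundary_arc three_halves_pi; congr arc_area.
congr (_ `|` _ `|` _); apply/seteqP; split => p [t /=]; rewrite in_itv /= => tr Ep.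
  exists (t - pi); first by rewrite /= in_itv /=; lra.
  by rewrite -edge_piD// [pi + _]addrC subrK.
by exists (pi + t); [rewrite /= in_itv /=; lra|rewrite edge_piD].
Qed.

Lemma segment_area_refl p q : segment_area (refl p) (refl q) = segment_area q p.
Proof. by rewrite /segment_area /cross /refl /=; ring. Qed.

(** The reflection in the vertical axis turns the arc of [D] into a lower left
    arc, followed in the opposite direction. *)
Lemma right_arc_value D phi g gam : body D -> 0 < phi < pi / 2 ->
  support D (3 * pi / 2 + (pi / 2 - phi)) = - g -> support D (3 * pi / 2 + 0) = 0 ->
  grounded (refl @` D) /\ exists v, forall Mu T,
  (forall y, is_derive y 1 Mu (profile (refl @` D) phi (Num.max 0 y))) -> v <= T ->
  segment_area (vminus D (3 * pi / 2 + (pi / 2 - phi)))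
      (refl (g *: uvec phi + gam *: vvec phi))
    + boundary_arc_area D (3 * pi / 2) (3 * pi / 2 + (pi / 2 - phi))
    + 2^-1 * (g ^+ 2 * tan phi + g * gam)
  = - ((Mu T - Mu 0 - T * g) / cos phi).
Proof.
move=> bD phir sg s0.
have /andP[phi0 phi2] := phir.
have c0 : 0 < cos phi by apply: cos_gt0_pihalf; lra.
pose B := refl @` D; have bB : body B := body_refl bD.
have LL : pi / 2 - (pi / 2 - phi) = phi by rewrite opprB addrC subrK.
have supE s : support B (pi + (pi / 2 - s)) = support D (3 * pi / 2 + s).
  have [p [Dp E] H] := support_exposed (3 * pi / 2 + s) bD.
  rewrite -E dot_uvec_three_halves -dot_uvec_piD; apply: support_eq => //; first by exists p.
  move=> _ [q Dq <-]; rewrite !dot_uvec_piD -!dot_uvec_three_halves.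
  by rewrite E; exact: H.
have gB : grounded B by apply: grounded_support => //; rewrite -s0 -supE subr0.
split => //.
have [YE Ymin] := vminus_edge (3 * pi / 2 + (pi / 2 - phi)) bD.
have [WE Wmax] := vplus_edge (3 * pi / 2 + 0) bD.
pose Y := vminus D (3 * pi / 2 + (pi / 2 - phi)); pose W := vplus D (3 * pi / 2 + 0).
pose X := refl Y; pose Z := refl W.
have gX : g = dot X (uvec phi).
  by apply: oppr_inj; rewrite -sg -(proj2 YE) dot_uvec_three_halves LL.
have lowX : lowest B phi X by rewrite -LL; apply/edge_three_halves.
have BZ : B Z by exists W => //; exact: (proj1 WE).
have Z0 : Z.2 = 0.
  have := proj2 WE; rewrite s0 dot_uvec_three_halves subr0 dot_uvec_pihalf => /eqP.
  by rewrite oppr_eq0 => /eqP.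
have leftZ q : B q -> q.2 = 0 -> Z.1 <= q.1.
  move=> [r Dr <-] r0.
  have : edge D (3 * pi / 2 + 0) r.
    by split => //; rewrite s0 dot_uvec_three_halves subr0 dot_uvec_pihalf r0 oppr0.
  move=> /Wmax; rewrite !dot_vvec_three_halves subr0 !dot_vvec_pihalf.
  by rewrite lerN2.
have botX q : lowest B phi q -> X.2 <= q.2.
  move=> lq; apply: (snd_le_of_vvec c0).
    by apply/eqP; rewrite eq_le (proj2 lowX _ (proj1 lq)) (proj2 lq _ (proj1 lowX)).
  have : edge D (3 * pi / 2 + (pi / 2 - phi)) (refl q).
    by apply/edge_three_halves => //; rewrite LL reflK.
  by move=> /Ymin; rewrite !dot_vvec_three_halves LL reflK.
exists X.2 => Mu T HMu XT.
have [H H'] := lower_arc_value gam gB phir lowX botX BZ Z0 leftZ HMu XT.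
rewrite -gX in H; rewrite -H; congr (_ + _ + _).
  by rewrite -segment_area_refl reflK.
rewrite -H' /boundary_arc_area /boundary_arc /X /Z !reflK -/Y.
have -> : vplus D (3 * pi / 2) = W by rewrite /W addr0.
congr arc_area.
apply/seteqP; split => [p [[->|[t /=]]|->]|_ [p + <-]]; last move=> [[->|[t /=]]|->].
- by exists Z; [right|rewrite /Z reflK].
- rewrite in_itv /= => tr Ep; exists (refl p); last by rewrite reflK.
  left; right; exists (pi / 2 - (t - 3 * pi / 2)); first by rewrite /= in_itv /=; lra.
  by apply/edge_three_halves => //; rewrite [3 * pi / 2 + _]addrC subrK.
- by exists X; [left; left|rewrite /X reflK].
- by rewrite /X reflK; right.
- rewrite in_itv /= => tr lp; left; right.
  exists (3 * pi / 2 + (pi / 2 - t)); first by rewrite /= in_itv /=; lra.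
  by apply/edge_three_halves => //; rewrite reflK opprB addrC subrK.
- by rewrite /Z reflK; left; left.
Qed.

Lemma profile_antiderivative_convex l B D phi Mb Md Ml T : 0 <= l <= 1 -> 0 <= T ->
  grounded B -> grounded D ->
  (forall y, is_derive y 1 Mb (profile B phi (Num.max 0 y))) ->
  (forall y, is_derive y 1 Md (profile D phi (Num.max 0 y))) ->
  (forall y, is_derive y 1 Ml (profile (minkowski_comb l B D) phi (Num.max 0 y))) ->
  Ml T - Ml 0 <= (1 - l) * (Mb T - Mb 0) + l * (Md T - Md 0).
Proof.
move=> l01 T0 gB gD HB HD HL.
suff : Ml T + - ((1 - l) * Mb T + l * Md T) <= Ml 0 + - ((1 - l) * Mb 0 + l * Md 0) by lra.
have dF y : is_derive y 1 (fun y => Ml y + - ((1 - l) * Mb y + l * Md y))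
  (profile (minkowski_comb l B D) phi (Num.max 0 y)
    + - ((1 - l) * profile B phi (Num.max 0 y) + l * profile D phi (Num.max 0 y))).
  apply: is_derive_eq (derive_add (HL y) (derive_opp (derive_add
    (derive_mul (derive_cst (1 - l) y) (HB y)) (derive_mul (derive_cst l y) (HD y))))) _.
  by rewrite !mulr0 !addr0.
apply: (derive_le0_le T0 (fun y _ => dF y)) => y _.
by rewrite subr_le0 profile_minkowski// le_max lexx.
Qed.

End niche_arcs.

(** * Planar measure of closed sets and rectangles *)

Section planar_area.
Context {R : realType}.
Implicit Types (K U : set (plane R)) (p q : plane R) (a b c M : R).

Let T := measurableTypeR R.

Lemma measurable_rectangle (A B : set R) : measurable A -> measurable B ->
  measurable (A `*` B : set (T * T)).
Proof. exact: measurableX. Qed.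

(** An open set is the union of the squares with rational centre and inverse
    integer radius that it contains. *)
Lemma open_plane_measurable U : open U -> measurable (U : set (T * T)).
Proof.
move=> oU.
pose sq (i : rat * rat * nat) : set (plane R) :=
  (ball (ratr i.1.1 : R) (i.2.+1%:R^-1) : set R) `*`
  (ball (ratr i.1.2 : R) (i.2.+1%:R^-1) : set R).
pose F i := if `[< sq i `<=` U >] then sq i else set0.
have -> : U = \bigcup_i F i.
  apply/seteqP; split => [p Up|p [n _]]; last first.
    by rewrite /F; case: asboolP => [H|_ []]; exact: H.
  have [e /= e0 He] : nbhs_ball p U by rewrite nbhs_ballE; exact: open_nbhs_nbhs.
  have [[//|n] _] := uniform_mesh ler01 (divr_gt0 e0 (ltr0n R 2)).
  rewrite subr0 mul1r => Hn.
  have n0 : 0 < n.+1%:R^-1 :> R by rewrite invr_gt0 ltr0n.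
  have /rat_in_itvoo[q1] : p.1 < p.1 + n.+1%:R^-1 by rewrite ltrDl.
  rewrite in_itv /= => /andP[a1 a2].
  have /rat_in_itvoo[q2] : p.2 < p.2 + n.+1%:R^-1 by rewrite ltrDl.
  rewrite in_itv /= => /andP[b1 b2].
  exists (q1, q2, n) => //; rewrite /F.
  have near0 (x z r : R) : x < z -> z < x + r -> `|z - x| < r.
    by move=> ? ?; rewrite ltr_norml; apply/andP; split; lra.
  have near (x y z r : R) : x < z -> z < x + r -> r < e / 2 -> `|z - y| < r -> `|x - y| < e.
    by move=> ? ? ?; rewrite !ltr_norml => /andP[? ?]; apply/andP; split; lra.
  have pq : sq (q1, q2, n) p by split; exact: near0.
  case: asboolP => // -[] q [/= h1 h2]; apply: He; split; rewrite /= /ball /=.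
    exact: near a1 a2 Hn h1.
  exact: near b1 b2 Hn h2.
apply: countable_bigcupT_measurable => [|i]; first exact: countableP.
rewrite /F.
case: asboolP => _; last exact: measurable0.
by apply: measurable_rectangle; apply: open_measurable; apply: ball_open; rewrite invr_gt0 ltr0n.
Qed.

Lemma closed_plane_measurable K : closed K -> measurable (K : set (T * T)).
Proof.
move=> cK; rewrite -[K]setCK; apply: measurableC.
by apply: open_plane_measurable; rewrite openC.
Qed.

Local Notation mu2 := (lebesgue_measure \x lebesgue_measure)%E.

Lemma rectangle_measure (i j : interval R) (u v : R) :
  lebesgue_measure ([set` i] : set R) = u%:E ->
  lebesgue_measure ([set` j] : set R) = v%:E ->
  mu2 ([set` i] `*` [set` j] : set (T * T)) = (u * v)%:E.
Proof.
move=> hi hj; have mi := measurable_itv i; have mj := measurable_itv j.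
transitivity (lebesgue_measure ([set` i] : set R) * lebesgue_measure ([set` j] : set R))%E.
  exact: (@product_measure1E _ _ T T R lebesgue_measure lebesgue_measure _ _ mi mj).
by rewrite hi hj.
Qed.

Lemma segment_measure a b : a <= b -> lebesgue_measure (`[a, b]%classic : set R) = (b - a)%:E.
Proof.
move=> ab; rewrite lebesgue_measure_itv /= lte_fin EFinB.
by case: ltgtP ab => // -> _; rewrite subee.
Qed.

Lemma halfopen_measure a b : a <= b -> lebesgue_measure (`]a, b]%classic : set R) = (b - a)%:E.
Proof.
move=> ab; rewrite lebesgue_measure_itv /= lte_fin EFinB.
by case: ltgtP ab => // -> _; rewrite subee.
Qed.

Lemma area_le_rectangle (X : set (plane R)) a b M : measurable (X : set (T * T)) ->
  a <= b -> 0 <= M ->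
  (forall p, X p -> a <= p.1 <= b /\ 0 <= p.2 <= M) ->
  mu2 (X : set (T * T)) \is a fin_num /\ area X <= (b - a) * M.
Proof.
move=> mX ab M0 HX.
have H : (mu2 (X : set (T * T)) <= ((b - a) * M)%:E)%E.
  have := rectangle_measure (segment_measure ab) (segment_measure M0).
  rewrite subr0 => <-.
  apply: le_measure; [by rewrite inE|by rewrite inE; apply: measurableX; exact: measurable_itv|].
  by move=> p /HX[h1 h2]; split; rewrite /= in_itv.
have fX : mu2 (X : set (T * T)) \is a fin_num.
  by rewrite ge0_fin_numE ?measure_ge0// (le_lt_trans H) ?ltry.
split; first exact: fX.
by rewrite -lee_fin /area fineK.
Qed.

End planar_area.

(** * Slabs of a body standing on the axis *)

Section slabs.
Context {R : realType}.
Implicit Types (K A X : set (plane R)) (p q : plane R) (a b c m M x y : R).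

Let T := measurableTypeR R.
Local Notation mu2 := (lebesgue_measure \x lebesgue_measure)%E.

(** With each point, such a body contains the vertical segment from it down to
    the axis, so its area is that below its upper boundary. Caps have this form,
    and it passes to Minkowski combinations directly. *)
Record standing K : Prop := Standing {
  standing_body : body K;
  standing_ge0 : forall p, K p -> 0 <= p.2;
  standing_foot : forall p, K p -> K (p.1, 0)
}.

Lemma standing_minkowski l K1 K2 : 0 <= l <= 1 -> standing K1 -> standing K2 ->
  standing (minkowski_comb l K1 K2).
Proof.
move=> l01 s1 s2; have /andP[l0 l1] := l01; split.
- by apply: body_minkowski => //; exact: standing_body.
- move=> _ [p Kp [q Kq <-]]; rewrite comb_snd addr_ge0// mulr_ge0//.
  + by lra.
  + exact: standing_ge0 s1 _ Kp.
  + exact: standing_ge0 s2 _ Kq.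
- move=> _ [p Kp [q Kq <-]]; exists (p.1, 0); first exact: standing_foot.
  exists (q.1, 0); first exact: standing_foot.
  by apply: injective_projections; rewrite ?comb_fst ?comb_snd /= ?mulr0 ?addr0// comb_fst.
Qed.

Variable K : set (plane R).
Hypothesis sK : standing K.

Let bK := standing_body sK.

Lemma standing_vertical p y : K p -> 0 <= y -> y <= p.2 -> K (p.1, y).
Proof.
move=> Kp y0; rewrite le_eqVlt => /predU1P[->|yp]; first by rewrite -surjective_pairing.
have p0 : 0 < p.2 by exact: le_lt_trans yp.
have l01 : 0 <= y / p.2 <= 1 by rewrite divr_ge0 ?(ltW p0)//= ler_pdivrMr// mul1r ltW.
have := body_convex bK l01 (standing_foot sK Kp) Kp.
congr (K _); apply: injective_projections; rewrite ?comb_fst ?comb_snd /=.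
  by ring.
by rewrite mulr0 add0r divfK// gt_eqF.
Qed.

Lemma standing_rectangle p q x y : K p -> K q -> p.1 <= x -> x <= q.1 ->
  0 <= y -> y <= p.2 -> y <= q.2 -> K (x, y).
Proof.
move=> Kp Kq px xq y0 yp yq.
have hp := standing_vertical Kp y0 yp; have hq := standing_vertical Kq y0 yq.
have [pq|] := eqVneq (q.1 - p.1) 0.
  by have -> : x = p.1 by lra.
move=> pq; have pq0 : 0 < q.1 - p.1 by rewrite lt_neqAle eq_sym pq; lra.
have l01 : 0 <= (x - p.1) / (q.1 - p.1) <= 1.
  by rewrite divr_ge0 ?subr_ge0 ?(ltW pq0)//= ?(le_trans px)// ler_pdivrMr// mul1r lerD2r.
have := body_convex bK l01 hp hq.
congr (K _); apply: injective_projections; rewrite ?comb_fst ?comb_snd /=.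
  by move: (p.1) (q.1) pq => u v uv; field.
by ring.
Qed.

Lemma standing_bounded : exists2 L : R, 0 <= L & forall p, K p -> - L <= p.1 <= L /\ p.2 <= L.
Proof.
have cN (f : plane R -> R) : continuous f -> continuous (fun p => - f p).
  by move=> cf p; apply: cvgN; exact: cf.
have [p1 _ H1] := compact_argmin (body_nonempty bK) (body_compact bK) fst_continuous.
have [p2 _ H2] := compact_argmin (body_nonempty bK) (body_compact bK) (cN _ fst_continuous).
have [p3 _ H3] := compact_argmin (body_nonempty bK) (body_compact bK) (cN _ snd_continuous).
exists (`|p1.1| + `|p2.1| + `|p3.2|); first by rewrite !addr_ge0.
move=> p Kp; have h1 := H1 _ Kp; have h2 := H2 _ Kp; have h3 := H3 _ Kp.
have n1 := ler_norm (- p1.1); rewrite normrN in n1.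
have n2 := ler_norm (p2.1); have n3 := ler_norm (p3.2).
have m1 := normr_ge0 (p1.1); have m2 := normr_ge0 (p2.1); have m3 := normr_ge0 (p3.2).
by lra.
Qed.

Definition area_left_of c : R := area (K `&` [set p | p.1 <= c]).

Let closed_left c : closed [set p : plane R | p.1 <= c].
Proof. by have /continuous_closedP/(_ _ (@closed_le R c)) := @fst_continuous R. Qed.

Let closed_K : closed K.
Proof. by apply: compact_closed; [exact: norm_hausdorff|exact: body_compact bK]. Qed.

Let measurable_left c : measurable (K `&` [set p | p.1 <= c] : set (T * T)).
Proof. by apply: closed_plane_measurable; apply: closedI. Qed.

Let measurable_slab a b : measurable (K `&` [set p | a < p.1 <= b] : set (T * T)).
Proof.
have -> : K `&` [set p | a < p.1 <= b] =
   (K `&` [set p | p.1 <= b]) `\` (K `&` [set p | p.1 <= a]).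
  apply/seteqP; split => p /=.
    by move=> [Kp /andP[ap pb]]; split => // -[_]; rewrite leNgt ap.
  by move=> [[Kp pb] h]; split => //; rewrite pb andbT ltNge; apply/negP => h'; apply: h.
exact: measurableD.
Qed.

Let fin_sub (X : set (plane R)) : measurable (X : set (T * T)) -> X `<=` K ->
  mu2 (X : set (T * T)) \is a fin_num.
Proof.
move=> mX XK; have [L L0 HL] := standing_bounded.
have [] // := @area_le_rectangle R X (- L) L L mX.
  by lra.
by move=> p /XK Kp; have [h1 h2] := HL _ Kp; rewrite h1 h2 (standing_ge0 sK Kp).
Qed.

Lemma area_slab a b : a <= b ->
  area_left_of b - area_left_of a = area (K `&` [set p | a < p.1 <= b]).
Proof.
move=> ab; rewrite /area_left_of.
have -> : K `&` [set p | p.1 <= b] =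
    (K `&` [set p | p.1 <= a]) `|` (K `&` [set p | a < p.1 <= b]).
  apply/seteqP; split => p /=.
    by move=> [Kp pb]; have [pa|ap] := leP p.1 a; [left|right].
  by move=> [[Kp pa]|[Kp /andP[_ pb]]]; split => //; exact: le_trans ab.
rewrite {1}/area measureU//; last first.
  apply/seteqP; split => p //= [[_ pa] [_ /andP[ap _]]].
  by move: (lt_le_trans ap pa); rewrite ltxx.
rewrite fineD ?fin_sub//.
by rewrite addrC addKr.
Qed.

Lemma slab_upper a b M : a <= b -> 0 <= M ->
  (forall p, K p -> a <= p.1 -> p.1 <= b -> p.2 <= M) ->
  area_left_of b - area_left_of a <= (b - a) * M.
Proof.
move=> ab M0 H; rewrite area_slab//.
apply: (@area_le_rectangle R _ a b M _ ab M0 _).2; first exact: measurable_slab.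
move=> p [Kp /= /andP[/ltW ap pb]].
by rewrite ap pb (standing_ge0 sK Kp) H.
Qed.

Lemma slab_lower p q m : K p -> K q -> p.1 <= q.1 -> 0 <= m ->
  m <= p.2 -> m <= q.2 ->
  (q.1 - p.1) * m <= area_left_of q.1 - area_left_of p.1.
Proof.
move=> Kp Kq pq m0 mp mq; rewrite area_slab//.
have RE := rectangle_measure (halfopen_measure pq) (segment_measure m0).
rewrite subr0 in RE.
rewrite -lee_fin -RE /area fineK; last by apply: fin_sub.
apply: le_measure; [|by rewrite inE|].
  by rewrite inE; apply: measurableX; exact: measurable_itv.
move=> [x y] [/=]; rewrite !in_itv /= => /andP[px xq] /andP[y0 ym].
split; last by rewrite /= px xq.
apply: (standing_rectangle Kp Kq) => //; first exact: ltW.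
  exact: le_trans mp.
exact: le_trans mq.
Qed.

Lemma area_left_of_min c : (forall p, K p -> c <= p.1) -> area_left_of c = 0.
Proof.
move=> H; have [L L0 HL] := standing_bounded.
apply/eqP; rewrite eq_le; apply/andP; split; last by rewrite /area_left_of /area fine_ge0.
have box p : (K `&` [set p | p.1 <= c]) p -> c <= p.1 <= c /\ 0 <= p.2 <= L.
  move=> [Kp /= pc]; rewrite (H _ Kp) pc (standing_ge0 sK Kp).
  by have [_ ->] := HL _ Kp.
have := (area_le_rectangle (measurable_left c) (lexx c) L0 box).2.
by rewrite subrr mul0r.
Qed.

Lemma area_left_of_max c : (forall p, K p -> p.1 <= c) -> area_left_of c = area K.
Proof.
move=> H; rewrite /area_left_of; congr area.
by apply/seteqP; split => p; [case|move=> Kp; split => //; exact: H].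
Qed.

End slabs.

(** * Contact points of the supporting lines *)

Section contact.
Context {R : realType}.
Implicit Types (K : set (plane R)) (p q : plane R) (f df N : R -> R) (a b s t x : R).

(** The contact point with the supporting line of normal [uvec t], when the
    support function is [f] and its derivative [df]. *)
Definition contact f df t : plane R := f t *: uvec t + df t *: vvec t.

Lemma contact_fst f df t : (contact f df t).1 = f t * cos t - df t * sin t.
Proof. by rewrite /contact /= /GRing.scale /=; ring. Qed.

Lemma contact_snd f df t : (contact f df t).2 = f t * sin t + df t * cos t.
Proof. by []. Qed.

Lemma dot_contact f df t : dot (contact f df t) (uvec t) = f t.
Proof.
rewrite /dot contact_fst contact_snd /uvec /=.
transitivity (f t * (cos t ^+ 2 + sin t ^+ 2)); first by ring.
by rewrite cos2Dsin2 mulr1.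
Qed.

Lemma frame_decomposition p t :
  p = dot p (uvec t) *: uvec t + dot p (vvec t) *: vvec t.
Proof.
have e2 := cos2Dsin2 t.
apply: injective_projections; rewrite /= /GRing.scale /= /dot /uvec /vvec /=.
  transitivity (p.1 * (cos t ^+ 2 + sin t ^+ 2)); first by rewrite e2 mulr1.
  by ring.
transitivity (p.2 * (cos t ^+ 2 + sin t ^+ 2)); first by rewrite e2 mulr1.
by ring.
Qed.

Lemma derive_dot_uvec p x :
  is_derive x 1 (fun t => dot p (uvec t)) (dot p (vvec x)).
Proof.
apply: is_derive_eq (derive_add (derive_mul (derive_cst p.1 x) (derive_cos x))
  (derive_mul (derive_cst p.2 x) (derive_sin x))) _.
by rewrite /dot /vvec /=; ring.
Qed.

Lemma contact_fst_continuous f df : continuous f -> continuous df ->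
  continuous (fun t => (contact f df t).1).
Proof.
move=> cf cdf.
have cc : continuous (fun t : R => cos t) by exact: derive_continuous (fun x => derive_cos x).
have cs : continuous (fun t : R => sin t) by exact: derive_continuous (fun x => derive_sin x).
have -> : (fun t => (contact f df t).1) = (fun t => f t * cos t - df t * sin t).
  by apply/funext => t; exact: contact_fst.
move=> t; apply: (@cvgB _ _ _ _ _ (fun t => f t * cos t) (fun t => df t * sin t)).
  by apply: cvgM; [exact: cf|exact: cc].
by apply: cvgM; [exact: cdf|exact: cs].
Qed.

Lemma contact_snd_continuous f df : continuous f -> continuous df ->
  continuous (fun t => (contact f df t).2).
Proof.
move=> cf cdf.
have cc : continuous (fun t : R => cos t) by exact: derive_continuous (fun x => derive_cos x).
have cs : continuous (fun t : R => sin t) by exact: derive_continuous (fun x => derive_sin x).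
move=> t; apply: (@cvgD _ _ _ _ _ (fun t => f t * sin t) (fun t => df t * cos t)).
  by apply: cvgM; [exact: cf|exact: cs].
by apply: cvgM; [exact: cdf|exact: cc].
Qed.

(** If [p] is on the edge of normal [uvec t], then [dot p (uvec x) - support K x]
    has a maximum at [x = t], so [dot p (vvec t)] is [df t]: the edge is a
    point. *)
Lemma contact_interior K f df a b t : body K ->
  (forall x, is_derive x 1 f (df x)) ->
  (forall x, a <= x <= b -> support K x = f x) -> a < t -> t < b ->
  K (contact f df t).
Proof.
move=> bK Hf Hs at_ tb.
have [p [Kp E] _] := support_exposed t bK.
suff -> : contact f df t = p by [].
have ab : a < b by exact: lt_trans tb.
pose g x := dot p (uvec x) + - f x.
have dg x : is_derive x 1 g (dot p (vvec x) + - df x).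
  exact: derive_add (derive_dot_uvec p x) (derive_opp (Hf x)).
have tab : t \in `]a, b[ by rewrite in_itv /= at_.
have Ht : support K t = f t by apply: Hs; rewrite !ltW.
have g0 : is_derive t 1 g 0.
  have gd x : x \in `]a, b[ -> derivable g x 1 by move=> _; have [] := dg x.
  apply: (derive1_at_max (ltW ab) gd tab) => x.
  rewrite in_itv /= => /andP[/ltW ax /ltW xb].
  rewrite /g E Ht subrr subr_le0 -Hs ?ax//.
  exact: dot_le_support bK Kp.
have D : dot p (vvec t) = df t.
  have [_ e1] := g0; have [_ e2] := dg t.
  by apply/eqP; rewrite -subr_eq0 -e2 e1.
by rewrite (frame_decomposition p t) E D Ht.
Qed.

(** At the end points of [a, b] the contact point is a limit of contact points
    with normals inside. *)
Lemma contact_body K f df a b t : body K -> a < b ->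
  (forall x, is_derive x 1 f (df x)) -> continuous df ->
  (forall x, a <= x <= b -> support K x = f x) -> a <= t <= b ->
  K (contact f df t).
Proof.
move=> bK ab Hf cdf Hs /andP[at_ tb].
have cf := derive_continuous Hf.
have closedK : closed K.
  by apply: compact_closed; [exact: norm_hausdorff|exact: body_compact bK].
have cC : continuous (contact f df).
  have E : contact f df = fun t => ((contact f df t).1, (contact f df t).2).
    by apply/funext => s; rewrite -surjective_pairing.
  rewrite E => s.
  exact: cvg_pair (@contact_fst_continuous _ _ cf cdf s) (@contact_snd_continuous _ _ cf cdf s).
move: at_; rewrite le_eqVlt => /predU1P[<-|at_].
  apply: (@closed_cvg _ _ (a^'+) _ (contact f df) K closedK); last first.
    exact: cvg_at_right_filter (cC a).
  near=> x; apply: (contact_interior bK Hf Hs) => //.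
move: tb; rewrite le_eqVlt => /predU1P[->|tb]; last exact: (contact_interior bK Hf Hs).
apply: (@closed_cvg _ _ (b^'-) _ (contact f df) K closedK); last first.
  exact: cvg_at_left_filter (cC b).
near=> x; apply: (contact_interior bK Hf Hs) => //.
Unshelve. all: by end_near. Qed.

End contact.

(** * Area swept by the contact point *)

Section cross_increment.
Context {R : realType}.
Implicit Types (f df N : R -> R) (a b s t x e : R).

Lemma cross_contact f df s t : cross (contact f df s) (contact f df t) =
  (f s * f t + df s * df t) * sin (t - s) + (f s * df t - df s * f t) * cos (t - s).
Proof.
rewrite /cross !contact_fst !contact_snd sinB cosB.
move: (cos s) (sin s) (cos t) (sin t) (f s) (f t) (df s) (df t) => a b c d h k p q.
by ring.
Qed.

Lemma norm_mul_le (x y u v : R) : `|x| <= u -> `|y| <= v -> `|x * y| <= u * v.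
Proof. by move=> xu yv; rewrite normrM ler_pM. Qed.

Lemma norm_sin_le x : `|sin x| <= `|x|.
Proof.
wlog x0 : x / 0 <= x.
  move=> H; have [x0|/ltW x0] := leP 0 x; first exact: H.
  by rewrite -normrN -sinN -[`|x|]normrN; apply: H; rewrite oppr_ge0.
have c1 (y : R) : 0 <= y <= x -> `|cos y| <= 1 by move=> _; exact: cos_max.
have := derive_bound x0 (fun y _ => derive_sin y) c1.
by rewrite sin0 !subr0 mul1r (ger0_norm x0).
Qed.

Lemma norm_cosB1_le x : `|cos x - 1| <= `|x|.
Proof.
wlog x0 : x / 0 <= x.
  move=> H; have [x0|/ltW x0] := leP 0 x; first exact: H.
  by rewrite -cosN -[`|x|]normrN; apply: H; rewrite oppr_ge0.
have s1 (y : R) : 0 <= y <= x -> `|- sin y| <= 1.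
  by move=> _; rewrite normrN; exact: sin_max.
have := derive_bound x0 (fun y _ => derive_cos y) s1.
by rewrite cos0 !subr0 mul1r (ger0_norm x0).
Qed.

(** Twice the area swept by the contact point is
    [d (f * df) + (f ^+ 2 - df ^+ 2) dt], although [df] need not be
    differentiable. With [df t] and [df s] frozen, the difference becomes a
    differentiable function of the current angle, and its derivative is small
    on short intervals. *)
Lemma cross_contact_increment f df N a b :
  (forall x, is_derive x 1 f (df x)) -> continuous df ->
  (forall x, is_derive x 1 N (f x ^+ 2 - df x ^+ 2)) ->
  forall e, 0 < e -> exists2 d : R, 0 < d &
    forall s t, a <= s -> s <= t -> t <= b -> t - s < d ->
    `|cross (contact f df s) (contact f df t)
       - ((f t * df t + N t) - (f s * df s + N s))| <= e * (t - s).
Proof.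
move=> Hf cdf HN e e0; have cf := derive_continuous Hf.
have [B1 B10 HB1] := segment_bounded (continuous_subspaceT cf : {within `[a, b], continuous f}).
have [B2 B20 HB2] := segment_bounded (continuous_subspaceT cdf : {within `[a, b], continuous df}).
pose B := B1 + B2 + 1.
have HfB x : a <= x <= b -> `|f x| <= B by move=> /HB1 h; rewrite /B; lra.
have HdB x : a <= x <= b -> `|df x| <= B by move=> /HB2 h; rewrite /B; lra.
have B_1 : 1 <= B by rewrite /B; lra.
clearbody B; clear B1 B10 HB1 B2 B20 HB2.
have B2_0 : 0 < 14 * B ^+ 2 by rewrite mulr_gt0// exprn_gt0//; lra.
pose r := e / (14 * B ^+ 2).
have r0 : 0 < r by rewrite divr_gt0.
have [d1 d10 Hd1] := segment_uniform_continuity (continuous_subspaceT cf : {within `[a, b], continuous f}) r0.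
have [d2 d20 Hd2] := segment_uniform_continuity (continuous_subspaceT cdf : {within `[a, b], continuous df}) r0.
exists (Num.min r (Num.min d1 d2)); first by rewrite !lt_min r0 d10 d20.
move=> s t sa st tb; rewrite !lt_min => /and3P[tr td1 td2].
rewrite cross_contact.
pose P := df t; pose Q := df s; pose C := f t * P - f s * Q.
pose Psi x := (((f s * f x + Q * P) * sin (x - s)
  + - ((f x - f s) * (P + Q) * cos (x - s))) + C * cos (x - s)) + - N x.
pose dPsi x := (f s * df x + (f x - f s) * (P + Q) - C) * sin (x - s)
  + (f s * f x + Q * P - df x * (P + Q)) * (cos (x - s) - 1)
  + (f x * (f s - f x) + (df x - P) * (df x - Q)).
have -> : (f s * f t + df s * df t) * sin (t - s)
    + (f s * df t - df s * f t) * cos (t - s) -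
    (f t * df t + N t - (f s * df s + N s)) = Psi t - Psi s.
  rewrite /Psi subrr sin0 cos0 /C /P /Q.
  by move: (sin (t - s)) (cos (t - s)) => u v; ring.
have dP x : is_derive x 1 Psi (dPsi x).
  have ds : is_derive x 1 (fun y => sin (y - s)) (cos (x - s)).
    by apply: derive_shift; exact: derive_sin.
  have dc : is_derive x 1 (fun y => cos (y - s)) (- sin (x - s)).
    by apply: derive_shift; exact: derive_cos.
  apply: is_derive_eq (derive_add (derive_add (derive_add
    (derive_mul (derive_add (derive_mul (derive_cst (f s) x) (Hf x)) (derive_cst (Q * P) x)) ds)
    (derive_opp (derive_mul (derive_mul (derive_add (Hf x) (derive_cst (- f s) x)) (derive_cst (P + Q) x)) dc)))
    (derive_mul (derive_cst C x) dc)) (derive_opp (HN x))) _.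
  rewrite /dPsi; move: (sin (x - s)) (cos (x - s)) => u v; ring.
apply: (derive_bound st (fun x _ => dP x)) => x /andP[sx xt].
have sab : a <= s <= b by rewrite sa (le_trans st).
have tab : a <= t <= b by rewrite tb (le_trans sa).
have xab : a <= x <= b by rewrite (le_trans sa)// (le_trans xt).
have small : `|x - s| <= r by rewrite ger0_norm; lra.
have hs : `|sin (x - s)| <= r := le_trans (norm_sin_le _) small.
have hc : `|cos (x - s) - 1| <= r := le_trans (norm_cosB1_le _) small.
have hf : `|f s - f x| <= r.
  by apply/ltW/Hd1 => //; rewrite distrC ger0_norm; lra.
have hP : `|df x - P| <= B + B.
  by apply: le_trans (ler_normB _ _) _; apply: lerD; apply: HdB.
have hQ : `|df x - Q| <= r.
  by apply/ltW/Hd2 => //; rewrite ger0_norm; lra.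
have hfs := HfB _ sab; have hft := HfB _ tab; have hfx := HfB _ xab.
have hds := HdB _ sab; have hdt := HdB _ tab; have hdx := HdB _ xab.
have hPQ : `|P + Q| <= B + B by apply: le_trans (ler_normD _ _) _; exact: lerD.
have hC : `|C| <= B * B + B * B.
  by apply: le_trans (ler_normB _ _) _; apply: lerD; exact: norm_mul_le.
have k1 : `|f s * df x + (f x - f s) * (P + Q) - C| <= B * B + (B + B) * (B + B) + (B * B + B * B).
  apply: le_trans (ler_normB _ _) _; apply: lerD => //.
  apply: le_trans (ler_normD _ _) _; apply: lerD; first exact: norm_mul_le.
  apply: norm_mul_le => //.
  by apply: le_trans (ler_normB _ _) _; exact: lerD.
have k2 : `|f s * f x + Q * P - df x * (P + Q)| <= B * B + B * B + B * (B + B).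
  apply: le_trans (ler_normB _ _) _; apply: lerD; last exact: norm_mul_le.
  by apply: le_trans (ler_normD _ _) _; apply: lerD; exact: norm_mul_le.
have k3 := norm_mul_le k1 hs; have k4 := norm_mul_le k2 hc.
have k5 := norm_mul_le hfx hf; have k6 := norm_mul_le hP hQ.
have e_r : e = r * (14 * B ^+ 2) by rewrite /r divfK// gt_eqF.
apply: le_trans (ler_normD _ _) _.
apply: le_trans (lerD (le_trans (ler_normD _ _) (lerD k3 k4)) (le_trans (ler_normD _ _) (lerD k5 k6))) _.
rewrite e_r.
have -> : (B * B + (B + B) * (B + B) + (B * B + B * B)) * r +
  (B * B + B * B + B * (B + B)) * r + (B * r + (B + B) * r) = r * (11 * B ^+ 2 + 3 * B) by ring.
rewrite ler_pM2l//.
have : B <= B ^+ 2 by rewrite expr2 ler_peMr//; lra.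
by lra.
Qed.

End cross_increment.

(** * Area of a body standing on the axis *)

Section cap_area.
Context {R : realType}.
Implicit Types (p q : plane R) (f df N Nh Nk h dh k dk : R -> R) (a b s t x e : R).

Variable K : set (plane R).
Hypothesis sK : standing K.

Let bK := standing_body sK.
Let S := area_left_of K.

Section boundary_piece.
Variables (f df N : R -> R) (a b : R).
Hypothesis ab : a < b.
Hypothesis quadrant : 0 <= a /\ b <= pi / 2 \/ pi / 2 <= a /\ b <= pi.
Hypothesis Hf : forall x, is_derive x 1 f (df x).
Hypothesis cdf : continuous df.
Hypothesis Hs : forall x, a <= x <= b -> support K x = f x.
Hypothesis HN : forall x, is_derive x 1 N (f x ^+ 2 - df x ^+ 2).

Let X := contact f df.

Let KX t : a <= t <= b -> K (X t).
Proof. exact: (contact_body bK ab Hf cdf Hs). Qed.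

Let maxX t q : a <= t <= b -> K q -> dot q (uvec t) <= dot (X t) (uvec t).
Proof. by move=> tab Kq; rewrite dot_contact -Hs//; exact: dot_le_support. Qed.

Let pi0 : 0 < pi :> R := pi_gt0 R.

(** Each of two contact points lies below the supporting line at the other. *)
Lemma contact_fst_nonincreasing s t : a <= s -> s <= t -> t <= b ->
  (X t).1 <= (X s).1.
Proof.
move=> sa; rewrite le_eqVlt => /predU1P[->//|st] tb.
have sab : a <= s <= b by rewrite sa (le_trans (ltW st)).
have tab : a <= t <= b by rewrite tb (le_trans sa (ltW st)).
have h1 := maxX sab (KX tab); have h2 := maxX tab (KX sab).
have ss : 0 <= sin s by apply: sin_ge0_pi; case: quadrant; lra.
have st' : 0 <= sin t by apply: sin_ge0_pi; case: quadrant; lra.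
have d0 : 0 < sin (t - s) by apply: sin_gt0_pi; case: quadrant; lra.
move: h1 h2 d0; rewrite sinB /dot /uvec; move: (X s) (X t) => [xs ys] [xt yt] /=.
move: (cos s) (sin s) (cos t) (sin t) ss st' => cs_ ss_ ct_ st_ ss0 st0 h1 h2 d0.
rewrite -subr_ge0 -(pmulr_rge0 _ d0).
have g1 : 0 <= (xs * cs_ + ys * ss_ - (xt * cs_ + yt * ss_)) * st_ by rewrite mulr_ge0// subr_ge0.
have g2 : 0 <= (xt * ct_ + yt * st_ - (xs * ct_ + ys * st_)) * ss_ by rewrite mulr_ge0// subr_ge0.
have := addr_ge0 g1 g2; congr (0 <= _); ring.
Qed.

Let slab_height s t p : a <= s -> s < t -> t <= b -> K p ->
  (X t).1 <= p.1 -> p.1 <= (X s).1 -> p.2 <= Num.max (X s).2 (X t).2.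
Proof.
move=> sa st tb Kp tp ps.
have sab : a <= s <= b by rewrite sa (le_trans (ltW st)).
have tab : a <= t <= b by rewrite tb (le_trans sa (ltW st)).
rewrite le_max; apply/orP; case: quadrant => -[q1 q2]; [right|left].
- have h := maxX tab Kp.
  have s0 : 0 < sin t by apply: sin_gt0_pi; lra.
  have c0 : 0 <= cos t by apply: cos_ge0_pihalf; lra.
  move: h tp; rewrite /dot /uvec; case: (X t) => xt yt /= h tp.
  have : xt * cos t <= p.1 * cos t by rewrite ler_wpM2r.
  by move=> hh; rewrite -(ler_pM2r s0); lra.
- have h := maxX sab Kp.
  have s0 : 0 < sin s by apply: sin_gt0_pi; lra.
  have c0 : 0 <= - cos s.
    by rewrite -sinBpihalf; apply: sin_ge0_pi; lra.
  move: h ps; rewrite /dot /uvec; case: (X s) => xs ys /= h ps.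
  have : p.1 * - cos s <= xs * - cos s by rewrite ler_wpM2r.
  by move=> hh; rewrite -(ler_pM2r s0); lra.
Qed.

(** Within one quadrant the height is monotone along the boundary, so the slab
    between two contact points contains the rectangle under the lower one and is
    contained in the rectangle under the higher one. *)
Lemma trapezoid_error s t : a <= s -> s < t -> t <= b ->
  `|2 * (S (X s).1 - S (X t).1) - ((X s).1 - (X t).1) * ((X s).2 + (X t).2)|
    <= ((X s).1 - (X t).1) * `|(X t).2 - (X s).2|.
Proof.
move=> sa st tb.
have sab : a <= s <= b by rewrite sa (le_trans (ltW st)).
have tab : a <= t <= b by rewrite tb (le_trans sa (ltW st)).
have xx := contact_fst_nonincreasing sa (ltW st) tb.
have ys := standing_ge0 sK (KX sab); have yt := standing_ge0 sK (KX tab).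
have M0 : 0 <= Num.max (X s).2 (X t).2 by rewrite le_max ys.
have up := slab_upper sK xx M0 (fun p Kp u v => slab_height sa st tb Kp u v).
have m0 : 0 <= Num.min (X s).2 (X t).2 by rewrite le_min ys yt.
have lo := slab_lower sK (KX tab) (KX sab) xx m0
  (_ : _ <= (X t).2) (_ : _ <= (X s).2).
have {}lo := lo ltac:(by rewrite ge_min lexx orbT) ltac:(by rewrite ge_min lexx).
have d0 : 0 <= (X s).1 - (X t).1 by rewrite subr_ge0.
move: up lo d0; rewrite -/S.
move: (S (X s).1) (S (X t).1) (X s).1 (X t).1 (X s).2 (X t).2 => A A' xs xt ys' yt'.
rewrite /Num.max /Num.min; case: ltP => h up lo d0.
  rewrite (ger0_norm (_ : 0 <= yt' - ys')) ?subr_ge0 ?(ltW h)//.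
  by rewrite ler_norml; apply/andP; split; lra.
rewrite (ler0_norm (_ : yt' - ys' <= 0)) ?subr_le0//.
by rewrite ler_norml; apply/andP; split; lra.
Qed.

(** The area under the boundary and the area swept from the origin differ by an
    exact term, and both are computed by small increments. *)
Lemma boundary_piece_area :
  2 * (S (X a).1 - S (X b).1) =
  (f b * df b + N b - (X b).1 * (X b).2) - (f a * df a + N a - (X a).1 * (X a).2).
Proof.
have cf := derive_continuous Hf.
pose G t := 2 * S (X t).1 + (f t * df t + N t - (X t).1 * (X t).2).
suff : G b = G a by rewrite /G; lra.
apply: (@eq_of_small_increments _ G (fun t => t - (X t).1)); first exact: ltW.
move=> e e0.
have [d1 d10 H1] := cross_contact_increment a b Hf cdf HN e0.
have cy := contact_snd_continuous cf cdf.
have [d2 d20 H2] := segment_uniform_continuity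
  (continuous_subspaceT cy : {within `[a, b], continuous (fun t => (contact f df t).2)}) e0.
exists (Num.min d1 d2) => [|s t sa st tb]; first by rewrite lt_min d10.
rewrite lt_min => /andP[td1 td2].
move: st; rewrite le_eqVlt => /predU1P[->|st]; first by rewrite !subrr normr0 mulr0.
have sab : a <= s <= b by rewrite sa (le_trans (ltW st)).
have tab : a <= t <= b by rewrite tb (le_trans sa (ltW st)).
have k1 := H1 _ _ sa (ltW st) tb td1.
have k2 := trapezoid_error sa st tb.
have xx := contact_fst_nonincreasing sa (ltW st) tb.
have k3 : `|(X t).2 - (X s).2| <= e.
  by apply/ltW/H2 => //; rewrite ger0_norm; lra.
have k4 : ((X s).1 - (X t).1) * `|(X t).2 - (X s).2| <= ((X s).1 - (X t).1) * e.
  by rewrite ler_wpM2l// subr_ge0.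
have -> : G t - G s =
  - (2 * (S (X s).1 - S (X t).1) - ((X s).1 - (X t).1) * ((X s).2 + (X t).2))
  - (cross (X s) (X t) - ((f t * df t + N t) - (f s * df s + N s))).
  by rewrite /G /cross; ring.
apply: le_trans (ler_normB _ _) _; rewrite normrN.
apply: le_trans (lerD (le_trans k2 k4) k1) _.
by rewrite le_eqVlt; apply/orP; left; apply/eqP; ring.
Qed.

End boundary_piece.

(** One piece per quadrant, and between them the slab below the edge of normal
    [pi / 2], which is a rectangle of height 1. The boundary terms cancel. *)
Lemma standing_area h dh k dk Nh Nk :
  support K (pi / 2) = 1 ->
  (forall x, is_derive x 1 h (dh x)) -> continuous dh ->
  (forall x, 0 <= x <= pi / 2 -> support K x = h x) ->
  (forall x, is_derive x 1 k (dk x)) -> continuous dk ->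
  (forall x, 0 <= x <= pi / 2 -> support K (x + pi / 2) = k x) ->
  (forall x, is_derive x 1 Nh (h x ^+ 2 - dh x ^+ 2)) ->
  (forall x, is_derive x 1 Nk (k x ^+ 2 - dk x ^+ 2)) ->
  2 * area K = (Nh (pi / 2) - Nh 0) + (Nk (pi / 2) - Nk 0).
Proof.
move=> K1 Hh cdh sh Hk cdk sk HNh HNk.
have pi0 : 0 < pi :> R := pi_gt0 R.
have pi20 : 0 < pi / 2 :> R by lra.
have p2p : pi / 2 + pi / 2 = pi :> R by lra.
(* the second quadrant, in the angle of the normal *)
pose f x := k (x + - (pi / 2)); pose df x := dk (x + - (pi / 2)).
pose N x := Nk (x + - (pi / 2)).
have Hf x : is_derive x 1 f (df x) by exact: derive_shift (Hk _).
have HN x : is_derive x 1 N (f x ^+ 2 - df x ^+ 2) by exact: derive_shift (HNk _).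
have cdf : continuous df.
  move=> x; apply: (@continuous_comp _ _ _ (fun x => x + - (pi / 2)) dk); last exact: cdk.
  exact: is_derive_continuous (derive_add (derive_id x) (derive_cst _ x)).
have sf x : pi / 2 <= x <= pi -> support K x = f x.
  by move=> xp; rewrite /f -sk ?subrK//; lra.
have q1 : 0 <= 0 :> R /\ pi / 2 <= pi / 2 :> R \/ pi / 2 <= 0 :> R /\ pi / 2 <= pi :> R by left; split; lra.
have q2 : 0 <= pi / 2 :> R /\ pi <= pi / 2 :> R \/ pi / 2 <= pi / 2 :> R /\ pi <= pi :> R by right; split; lra.
have p2lt : pi / 2 < pi :> R by lra.
have X1K t : 0 <= t <= pi / 2 -> K (contact h dh t) by exact: (contact_body bK pi20 Hh cdh sh).
have X2K t : pi / 2 <= t <= pi -> K (contact f df t) by exact: (contact_body bK p2lt Hf cdf sf).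
have I1 : (0 : R) <= pi / 2 <= (pi / 2 : R) by rewrite lexx ltW.
have hp : h (pi / 2) = 1 := etrans (esym (sh _ I1)) K1.
have I2 : (pi / 2 : R) <= (pi / 2 : R) <= (pi : R) by rewrite lexx ltW.
have fp : f (pi / 2) = 1 := etrans (esym (sf _ I2)) K1.
have le1 p : K p -> p.2 <= 1.
  move=> Kp; have := dot_le_support (pi / 2) bK Kp.
  by rewrite K1 /dot /uvec /= cos_pihalf sin_pihalf mulr0 mulr1 add0r.
(* the edge of normal [pi / 2], at height 1 *)
pose P1 := contact h dh (pi / 2); pose P2 := contact f df (pi / 2).
have P1E : P1 = (- dh (pi / 2), 1).
  apply: injective_projections; rewrite /P1 ?contact_fst ?contact_snd.
    by rewrite cos_pihalf sin_pihalf mulr0 mulr1 sub0r.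
  by rewrite cos_pihalf sin_pihalf mulr0 mulr1 addr0 hp.
have P2E : P2 = (- df (pi / 2), 1).
  apply: injective_projections; rewrite /P2 ?contact_fst ?contact_snd.
    by rewrite cos_pihalf sin_pihalf mulr0 mulr1 sub0r.
  by rewrite cos_pihalf sin_pihalf mulr0 mulr1 addr0 fp.
have KP1 : K (- dh (pi / 2), 1) by rewrite -P1E; exact: X1K.
have KP2 : K (- df (pi / 2), 1) by rewrite -P2E; exact: X2K.
have edge_slab u v : u <= v -> K (u, 1) -> K (v, 1) -> S v - S u = v - u.
  move=> uv Ku Kv; apply/eqP; rewrite eq_le; apply/andP; split.
    by rewrite -[leRHS]mulr1; apply: slab_upper => // p Kp _ _; exact: le1.
  by rewrite -[leLHS]mulr1; exact: (slab_lower sK Ku Kv uv ler01).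
have A3 : S (- dh (pi / 2)) - S (- df (pi / 2)) = df (pi / 2) - dh (pi / 2).
  have [uv|/ltW uv] := leP (- df (pi / 2)) (- dh (pi / 2)).
    by rewrite edge_slab//; ring.
  by have := edge_slab _ _ uv KP1 KP2; lra.
have s0 : support K 0 = h 0 by apply: sh; rewrite lexx ltW.
have spi : support K pi = f pi by apply: sf; rewrite lexx ltW.
have A4 : S (h 0) = area K.
  apply: area_left_of_max => p Kp.
  have := dot_le_support 0 bK Kp.
  by rewrite s0 /dot /uvec cos0 sin0 /= mulr1 mulr0 addr0.
have A5 : S (- f pi) = 0.
  apply: area_left_of_min => // p Kp.
  have := dot_le_support pi bK Kp.
  rewrite spi /dot /uvec cospi sinpi /= mulrN1 mulr0 addr0.
  by rewrite lerNl.
have NE : N pi - N (pi / 2) = Nk (pi / 2) - Nk 0.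
  by rewrite /N subrr; congr (Nk _ - _); lra.
have A1 := boundary_piece_area pi20 q1 Hh cdh sh HNh.
have A2 := boundary_piece_area p2lt q2 Hf cdf sf HN.
move: A1 A2; rewrite !contact_fst !contact_snd.
rewrite cos0 sin0 cos_pihalf sin_pihalf cospi sinpi hp fp.
rewrite !mulr0 !mulr1 !mulrN1 !add0r !addr0 !subr0 => A1 A2.
rewrite A4 in A1; rewrite A5 in A2.
clearbody S f df N; clear -A1 A2 A3 NE.
by lra.
Qed.

End cap_area.

(** * Extension of C1 functions *)

Section C1_extension.
Context {R : realType}.
Implicit Types (f df g F dF : R -> R) (a b s t x e d : R).

Lemma is_derive0_of_bound g t :
  (forall e, 0 < e -> exists2 d : R, 0 < d &
    forall s, `|s - t| < d -> `|g s - g t| <= e * `|s - t|) ->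
  is_derive t 1 g 0.
Proof.
move=> H.
have : (fun r : R => r^-1 *: (g (r *: (1 : R) + t) - g t)) @ 0^' --> (0 : R).
  apply/cvgrPdist_le => e /H[d d0 Hd].
  near=> r; rewrite sub0r normrN normrM normfV.
  have r0 : r != 0 by near: r; exact: nbhs_dnbhs_neq.
  rewrite mulrC ler_pdivrMr ?normr_gt0//.
  have := Hd (r *: (1 : R) + t); rewrite addrK {1 3}/GRing.scale /= mulr1; apply.
  near: r; apply: dnbhs0_lt; exact: d0.
move=> C; apply: DeriveDef; first by apply/cvg_ex; exists 0.
by apply/cvg_lim.
Unshelve. all: by end_near. Qed.

Definition clamp a b x : R := Num.min b (Num.max a x).

Lemma clamp_in a b x : a <= b -> a <= clamp a b x <= b.
Proof.
by move=> ab; rewrite /clamp le_min ge_min ab le_max !lexx.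
Qed.

Lemma clamp_id a b x : a <= x <= b -> clamp a b x = x.
Proof. by move=> /andP[ax xb]; rewrite /clamp (max_idPr ax) (min_idPr xb). Qed.

Lemma clamp_contraction a b s t : a <= b -> `|clamp a b s - clamp a b t| <= `|s - t|.
Proof.
wlog st : s t / s <= t.
  move=> H ab; have [st|/ltW ts] := leP s t; first exact: H.
  by rewrite distrC [leRHS]distrC; exact: H.
move=> ab; rewrite distrC [leRHS]distrC (ger0_norm (_ : 0 <= t - s)) ?subr_ge0//.
rewrite /clamp /Num.max /Num.min; case: (ltP a s); case: (ltP a t);
  case: (ltP b a); case: (ltP b s); case: (ltP b t) => *;
  rewrite ler_norml; apply/andP; split; lra.
Qed.

Lemma clamp_continuous_comp a b df : a <= b -> {within `[a, b], continuous df} ->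
  continuous (fun x => df (clamp a b x)).
Proof.
move=> ab cdf x; apply/cvgrPdist_lt => e e0.
have [d d0 Hd] := segment_uniform_continuity cdf e0.
exists d => //= y; rewrite /ball_ /= => xy; apply: Hd; rewrite ?clamp_in//.
exact: le_lt_trans (clamp_contraction x y ab) xy.
Qed.

(** The derivative is extended by constants and integrated. The difference with
    [f], precomposed with the projection onto the segment, has derivative zero
    everywhere, also at the end points. *)
Lemma C1_extension f df a b : a < b -> {within `[a, b], continuous df} ->
  (forall t, t \in `[a, b] ->
    (fun s : R => (s - t)^-1 * (f s - f t)) @ within `[a, b] (t^') --> df t) ->
  exists F dF, [/\ forall x, is_derive x 1 F (dF x), continuous dF &
    forall x, a <= x <= b -> F x = f x].
Proof.
move=> ab cdf Hf; have ab' := ltW ab.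
pose dF x := df (clamp a b x).
have cdF : continuous dF := clamp_continuous_comp ab' cdf.
have [F0 HF0] := antiderivative_exists cdF.
exists (fun x => F0 x + (f a - F0 a)), dF; split => //.
  by move=> x; apply: is_derive_eq (derive_add (HF0 x) (derive_cst _ x)) _; rewrite addr0.
pose g x := f (clamp a b x) - F0 (clamp a b x).
have dg t : is_derive t 1 g 0.
  apply: is_derive0_of_bound => e e0.
  have e2 : 0 < e / 2 by rewrite divr_gt0.
  pose c := clamp a b t.
  have cab : a <= c <= b := clamp_in t ab'.
  have cin : c \in `[a, b] by rewrite in_itv.
  have /cvgrPdist_lt/(_ _ e2)[d1 /= d10 H1] := Hf _ cin.
  have [d2 d20 H2] := segment_uniform_continuity
    (continuous_subspaceT cdF : {within `[a, b], continuous dF}) e2.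
  exists (Num.min d1 d2) => [|s]; first by rewrite lt_min d10.
  rewrite lt_min => /andP[sd1 sd2].
  have scc := clamp_contraction s t ab'.
  apply: le_trans (ler_wpM2l (ltW e0) scc).
  rewrite /g -/c; move: scc; set u := clamp a b s => scc.
  have uab : a <= u <= b := clamp_in s ab'.
  have [->|uc] := eqVneq u c; first by rewrite !subrr normr0 mulr0.
  have k1 : `|f u - f c - df c * (u - c)| <= e / 2 * `|u - c|.
    have := H1 u _ uc; rewrite /ball_ /= distrC.
    move=> /(_ (le_lt_trans scc sd1)); rewrite in_itv /= => /(_ uab) k.
    have uc0 : u - c != 0 by rewrite subr_eq0.
    have -> : f u - f c - df c * (u - c) =
      - (df c - (u - c)^-1 * (f u - f c)) * (u - c) by field.
    by rewrite normrM normrN ler_wpM2r// ltW.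
  have k2 : `|F0 u - F0 c - df c * (u - c)| <= e / 2 * `|u - c|.
    have main p q : a <= p -> p <= q -> q <= b -> q - p < d2 ->
        (c = p \/ c = q) -> `|(F0 q + - (df c * q)) - (F0 p + - (df c * p))| <= e / 2 * (q - p).
      move=> ap pq qb qp cpq.
      have dH x : is_derive x 1 (fun x => F0 x + - (df c * x)) (dF x + - df c).
        apply: is_derive_eq (derive_add (HF0 x) (derive_opp (derive_mul (derive_cst (df c) x) (derive_id x)))) _.
        by ring.
      apply: (derive_bound pq (fun x _ => dH x)) => x /andP[px xq].
      have dFc : dF c = df c by rewrite /dF clamp_id.
      rewrite -dFc; apply/ltW/H2 => //; first by rewrite (le_trans ap)// (le_trans xq).
      by rewrite ltr_norml; apply/andP; split; case: cpq => ->; lra.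
    have [uc'|/ltW cu] := leP u c.
      have /andP[? ?] := uab; have /andP[? ?] := cab.
      have uc2 : c - u < d2.
        by apply: le_lt_trans sd2; apply: le_trans scc; rewrite distrC ler_norm.
      have := main u c; rewrite distrC [`|u - c|]distrC [`|c - u|]ger0_norm ?subr_ge0// => main'.
      apply: le_trans (main' _ _ _ _ _) => //; last by right.
      by rewrite le_eqVlt; apply/orP; left; apply/eqP; congr (`| _ |); ring.
    have /andP[? ?] := uab; have /andP[? ?] := cab.
    have uc2 : u - c < d2.
      by apply: le_lt_trans sd2; apply: le_trans scc; rewrite ler_norm.
    rewrite [`|u - c|]ger0_norm ?subr_ge0//.
    apply: le_trans (main c u _ _ _ _ _) => //; last by left.
    by rewrite le_eqVlt; apply/orP; left; apply/eqP; congr (`| _ |); ring.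
  have -> : f u - F0 u - (f c - F0 c) =
    (f u - f c - df c * (u - c)) - (F0 u - F0 c - df c * (u - c)) by ring.
  apply: le_trans (ler_normB _ _) _; apply: le_trans (lerD k1 k2) _.
  by rewrite -mulrDl -splitr.
move=> x xab; have := is_derive_0_is_cst x a dg.
rewrite /g clamp_id// clamp_id ?lexx//= => E.
by rewrite -E; ring.
Qed.

End C1_extension.

(** * The functional in the rotating frame *)

Section functional.
Context {R : realType}.
Implicit Types (p q : plane R) (K B D : set (plane R)) (t x y l phi T : R)
  (a da c dc al dal ga dga N Nh Nk M Mb Md : R -> R).

Lemma continuous_mul (f g : R -> R) : continuous f -> continuous g ->
  continuous (fun t => f t * g t).
Proof. by move=> cf cg t; apply: cvgM; [exact: cf|exact: cg]. Qed.

Lemma continuous_add (f g : R -> R) : continuous f -> continuous g ->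
  continuous (fun t => f t + g t).
Proof. by move=> cf cg t; apply: cvgD; [exact: cf|exact: cg]. Qed.

Lemma continuous_opp (f : R -> R) : continuous f -> continuous (fun t => - f t).
Proof. by move=> cf t; apply: cvgN; exact: cf. Qed.

(** The only half-planes that the projection of a point to the axis could leave
    are those of normal [3 * pi / 2], and these contain the axis. *)
Lemma cap_standing K : cap K -> standing K /\ support K (pi / 2) = 1.
Proof.
move=> [/convex_body_body bK K1 K0 [H Hr KE]]; split => //.
have u3 p : dot p (uvec (3 * pi / 2)) = - p.2.
  by rewrite three_halves_pi dot_uvec_piD dot_uvec_pihalf.
have Kge0 p : K p -> 0 <= p.2.
  by move=> Kp; have := dot_le_support (3 * pi / 2) bK Kp; rewrite K0 u3 oppr_le0.
split => // p Kp.
have : (exists2 q, K q & q.2 = 0).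
  have [q [Kq E] _] := support_exposed (3 * pi / 2) bK.
  exists q => //; move: E; rewrite K0 u3 => /eqP.
  by rewrite oppr_eq0 => /eqP.
move=> [q Kq q0].
rewrite KE => t c Htc; have Kp' := Kp; have Kq' := Kq; rewrite KE in Kp' Kq'.
have [tp|t3] := Hr _ _ Htc.
- apply: le_trans (Kp' _ _ Htc); rewrite /dot /uvec /= mul0r addr0 lerDl.
  by rewrite mulr_ge0 ?Kge0// sin_ge0_pi.
- have := Kq' _ _ Htc; rewrite t3 !u3 q0 /=.
  by rewrite oppr0.
Qed.

Lemma inner_corner_support K t al ga :
  support K t - 1 = al t -> support K (t + pi / 2) - 1 = ga t ->
  inner_corner K t = (al t * cos t - ga t * sin t, al t * sin t + ga t * cos t).
Proof.
move=> E1 E2; rewrite /inner_corner E1 E2.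
by apply: injective_projections; rewrite /= /GRing.scale /=; ring.
Qed.

(** Here [al] and [ga] are the coordinates of the inner corner in the rotating
    frame, extended to functions of class C1 on the line. All conditions are
    stable under Minkowski combination. *)
Record frame_data phi K B D al dal ga dga : Prop := FrameData {
  data_standing : standing K;
  data_top : support K (pi / 2) = 1;
  data_B : body B;
  data_D : body D;
  data_dal : forall x, is_derive x 1 al (dal x);
  data_cal : continuous dal;
  data_al : forall x, 0 <= x <= pi / 2 -> support K x - 1 = al x;
  data_dga : forall x, is_derive x 1 ga (dga x);
  data_cga : continuous dga;
  data_ga : forall x, 0 <= x <= pi / 2 -> support K (x + pi / 2) - 1 = ga x;
  data_B_phi : support B (pi + phi) = - al phi;
  data_B_bottom : support B (pi + pi / 2) = 0;
  data_D_phi : support D (3 * pi / 2 + (pi / 2 - phi)) = - ga (pi / 2 - phi);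
  data_D_bottom : support D (3 * pi / 2 + 0) = 0
}.

Lemma data_exists phi K B D : 0 < phi < pi / 4 -> calL phi (K, B, D) ->
  exists al dal ga dga, frame_data phi K B D al dal ga dga.
Proof.
move=> /andP[phi0 phi4] [[[capK _ [_ _ [dx [cdx dxE] _]]] bB bD] _ [_ B1 B2] [_ D1 D2]].
have [sK K1] := cap_standing capK.
have pi0 : 0 < pi :> R := pi_gt0 R.
have p2 : 0 < pi / 2 :> R by rewrite divr_gt0.
have comp (pr : plane R -> R) : continuous pr ->
    (forall k p q, pr (k *: (p - q)) = k * (pr p - pr q)) ->
    exists F dF : R -> R, [/\ forall x, is_derive x 1 F (dF x), continuous dF &
      forall x, 0 <= x <= pi / 2 -> F x = pr (inner_corner K x)].
  move=> cpr prE.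
  apply: (@C1_extension _ (fun t => pr (inner_corner K t)) (fun t => pr (dx t)) _ _ p2).
    by move=> t; apply: (@cvg_comp _ _ _ dx pr _ _ _ (cdx t)); exact: cpr.
  move=> t tab; have := @cvg_comp _ _ _ _ pr _ _ _ (dxE t tab) (cpr (dx t)).
  rewrite (_ : pr \o _ = fun s => (s - t)^-1 * (pr (inner_corner K s) - pr (inner_corner K t)))//.
  by apply/funext => s; rewrite /= prE.
have [X [dX [HX cX EX]]] := comp _ (@fst_continuous R) (fun k p q => erefl).
have [Y [dY [HY cY EY]]] := comp _ (@snd_continuous R) (fun k p q => erefl).
pose al t := X t * cos t + Y t * sin t.
pose dal t := (X t * - sin t + cos t * dX t) + (Y t * cos t + sin t * dY t).
pose ga t := Y t * cos t - X t * sin t.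
pose dga t := (Y t * - sin t + cos t * dY t) - (X t * cos t + sin t * dX t).
have cc : continuous (fun t : R => cos t) by exact: derive_continuous (fun x => derive_cos x).
have cs : continuous (fun t : R => sin t) by exact: derive_continuous (fun x => derive_sin x).
have cXX := derive_continuous HX; have cYY := derive_continuous HY.
have alE x : 0 <= x <= pi / 2 -> support K x - 1 = al x.
  move=> xr; rewrite /al EX// EY// /inner_corner /= /GRing.scale /=.
  have e2 := cos2Dsin2 x.
  transitivity ((support K x - 1) * (cos x ^+ 2 + sin x ^+ 2)); first by rewrite e2 mulr1.
  move: (support K x) (support K _) (cos x) (sin x) => u v k s; ring.
have gaE x : 0 <= x <= pi / 2 -> support K (x + pi / 2) - 1 = ga x.
  move=> xr; rewrite /ga EX// EY// /inner_corner /= /GRing.scale /=.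
  have e2 := cos2Dsin2 x.
  transitivity ((support K (x + pi / 2) - 1) * (cos x ^+ 2 + sin x ^+ 2)); first by rewrite e2 mulr1.
  move: (support K x) (support K _) (cos x) (sin x) => u v k s; ring.
exists al, dal, ga, dga; split => //.
- exact: convex_body_body.
- exact: convex_body_body.
- move=> x; exact: derive_add (derive_mul (HX x) (derive_cos x)) (derive_mul (HY x) (derive_sin x)).
- by apply: continuous_add; apply: continuous_add; apply: continuous_mul => //; exact: continuous_opp.
- move=> x; exact: derive_add (derive_mul (HY x) (derive_cos x)) (derive_opp (derive_mul (HX x) (derive_sin x))).
- by apply: continuous_add; [|apply: continuous_opp]; apply: continuous_add; apply: continuous_mul => //; exact: continuous_opp.
- by rewrite -alE; [move: B1; clear; lra|lra].
- by move: B2; rewrite K1; clear; lra.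
- rewrite -gaE; last by lra.
  by move: D2; rewrite [pi / 2 + (pi / 2 - phi)]addrC; clear; lra.
- by move: D1; rewrite addr0 K1; clear; lra.
Qed.

Lemma data_combination l phi K1 B1 D1 K2 B2 D2 a1 da1 g1 dg1 a2 da2 g2 dg2 :
  0 <= l <= 1 ->
  frame_data phi K1 B1 D1 a1 da1 g1 dg1 ->
  frame_data phi K2 B2 D2 a2 da2 g2 dg2 ->
  frame_data phi (minkowski_comb l K1 K2) (minkowski_comb l B1 B2)
    (minkowski_comb l D1 D2)
    (fun x => (1 - l) * a1 x + l * a2 x) (fun x => (1 - l) * da1 x + l * da2 x)
    (fun x => (1 - l) * g1 x + l * g2 x) (fun x => (1 - l) * dg1 x + l * dg2 x).
Proof.
move=> l01 d1 d2.
have sK t := support_minkowski t l01 (standing_body (data_standing d1)) (standing_body (data_standing d2)).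
have sB t := support_minkowski t l01 (data_B d1) (data_B d2).
have sD t := support_minkowski t l01 (data_D d1) (data_D d2).
have dC (f df g dg : R -> R) : (forall x : R, is_derive x 1 f (df x)) -> (forall x : R, is_derive x 1 g (dg x)) ->
    forall x : R, is_derive x 1 (fun x => (1 - l) * f x + l * g x : R) ((1 - l) * df x + l * dg x).
  move=> Hf Hg x; apply: is_derive_eq (derive_add (derive_mul (derive_cst (1 - l) x) (Hf x))
    (derive_mul (derive_cst l x) (Hg x))) _.
  by ring.
have cC (f g : R -> R) : continuous f -> continuous g -> continuous (fun x : R => (1 - l) * f x + l * g x : R).
  move=> cf cg x; apply: (@cvgD _ _ _ _ _ (fun x => (1 - l) * f x) (fun x => l * g x)).
    by apply: cvgMl_tmp; exact: cf.
  by apply: cvgMl_tmp; exact: cg.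
split.
- by apply: standing_minkowski; [|exact: data_standing d1|exact: data_standing d2].
- by rewrite sK (data_top d1) (data_top d2); ring.
- by apply: body_minkowski; [|exact: data_B d1|exact: data_B d2].
- by apply: body_minkowski; [|exact: data_D d1|exact: data_D d2].
- exact: dC (data_dal d1) (data_dal d2).
- exact: cC (data_cal d1) (data_cal d2).
- by move=> x xr; rewrite sK -(data_al d1)// -(data_al d2)//; ring.
- exact: dC (data_dga d1) (data_dga d2).
- exact: cC (data_cga d1) (data_cga d2).
- by move=> x xr; rewrite sK -(data_ga d1)// -(data_ga d2)//; ring.
- by rewrite sB (data_B_phi d1) (data_B_phi d2); ring.
- by rewrite sB (data_B_bottom d1) (data_B_bottom d2); ring.
- by rewrite sD (data_D_phi d1) (data_D_phi d2); ring.
- by rewrite sD (data_D_bottom d1) (data_D_bottom d2); ring.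
Qed.

(** The last two lines are minus twice the areas between the arcs of [B] and [D]
    and their tangent lines. *)
Lemma calQ_formula phi K B D al dal ga dga :
  0 < phi < pi / 4 -> frame_data phi K B D al dal ga dga ->
  grounded B /\ grounded (refl @` D) /\
  exists v, forall Nh Nk M Mb Md T,
  (forall x, is_derive x 1 Nh ((al x + 1) ^+ 2 - dal x ^+ 2)) ->
  (forall x, is_derive x 1 Nk ((ga x + 1) ^+ 2 - dga x ^+ 2)) ->
  (forall x, is_derive x 1 M
     (al x ^+ 2 + ga x ^+ 2 + al x * dga x - ga x * dal x)) ->
  (forall y, is_derive y 1 Mb (profile B phi (Num.max 0 y))) ->
  (forall y, is_derive y 1 Md (profile (refl @` D) phi (Num.max 0 y))) ->
  v <= T ->
  let L := pi / 2 - phi in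
  2 * calQ phi (K, B, D) =
    (Nh (pi / 2) - Nh 0) + (Nk (pi / 2) - Nk 0) - (M L - M phi)
    - (al phi ^+ 2 * tan phi + al phi * ga phi)
    - (ga L ^+ 2 * tan phi + ga L * al L)
    - 2 * ((Mb T - Mb 0 - T * al phi) / cos phi)
    - 2 * ((Md T - Md 0 - T * ga L) / cos phi).
Proof.
move=> phir d; have /andP[phi0 phi4] := phir.
have pi0 : 0 < pi :> R := pi_gt0 R.
have phi2 : 0 < phi < pi / 2 by rewrite phi0; lra.
have [gB [v1 HB]] := left_arc_value (ga phi) (data_B d) phi2 (data_B_phi d) (data_B_bottom d).
have [gD [v2 HD]] := right_arc_value (al (pi / 2 - phi)) (data_D d) phi2 (data_D_phi d) (data_D_bottom d).
split => //; split => //.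
exists (Num.max v1 v2) => Nh Nk M Mb Md T HNh HNk HM HMb HMd; rewrite ge_max => /andP[v1T v2T] L.
have {HB v1T}qB := HB _ _ HMb v1T; have {HD v2T}qD := HD _ _ HMd v2T.
have dal1 x : is_derive x 1 (fun x => al x + 1) (dal x).
  by apply: is_derive_eq (derive_add (data_dal d x) (derive_cst 1 x)) _; rewrite addr0.
have dga1 x : is_derive x 1 (fun x => ga x + 1) (dga x).
  by apply: is_derive_eq (derive_add (data_dga d x) (derive_cst 1 x)) _; rewrite addr0.
have qK : 2 * area K = Nh (pi / 2) - Nh 0 + (Nk (pi / 2) - Nk 0).
  apply: (standing_area (data_standing d) (data_top d) dal1 (data_cal d) _ dga1 (data_cga d) _ HNh HNk).
    by move=> x xr; rewrite -(data_al d xr) subrK.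
  by move=> x xr; rewrite -(data_ga d xr) subrK.
have corner x : 0 <= x <= pi / 2 -> inner_corner K x =
    (al x * cos x - ga x * sin x, al x * sin x + ga x * cos x).
  by move=> xr; apply: inner_corner_support; [exact: (data_al d)|exact: (data_ga d)].
have qx : curve_area (inner_corner K) phi L = 2^-1 * (M L - M phi).
  have cc : continuous (fun t : R => cos t) by exact: derive_continuous (fun x => derive_cos x).
  have cs : continuous (fun t : R => sin t) by exact: derive_continuous (fun x => derive_sin x).
  have cal := derive_continuous (data_dal d); have cga := derive_continuous (data_dga d).
  pose dX x := (al x * - sin x + cos x * dal x) + - (ga x * cos x + sin x * dga x).
  pose dY x := (al x * cos x + sin x * dal x) + (ga x * - sin x + cos x * dga x).
  apply: (@curve_area_C1 _ _ (fun x => al x * cos x + - (ga x * sin x))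
    (fun x => al x * sin x + ga x * cos x) dX dY); rewrite ?/L; first by lra.
  - by move=> s sr; apply: corner; lra.
  - apply: continuous_add; [|apply: continuous_opp]; apply: continuous_add; apply: continuous_mul => //; [exact: continuous_opp|exact: (data_cal d)|exact: (data_cga d)].
  - by apply: continuous_add; apply: continuous_add; apply: continuous_mul => //; [exact: (data_cal d)|exact: continuous_opp|exact: (data_cga d)].
  - move=> x; exact: derive_add (derive_mul (data_dal d x) (derive_cos x)) (derive_opp (derive_mul (data_dga d x) (derive_sin x))).
  - move=> x; exact: derive_add (derive_mul (data_dal d x) (derive_sin x)) (derive_mul (data_dga d x) (derive_cos x)).
  - move=> x; apply: is_derive_eq (HM x) _; rewrite /dX /dY.
    have e2 := cos2Dsin2 x.
    transitivity ((al x ^+ 2 + ga x ^+ 2 + al x * dga x - ga x * dal x) * (cos x ^+ 2 + sin x ^+ 2)).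
      by rewrite e2 mulr1.
    move: (al x) (dal x) (ga x) (dga x) (cos x) (sin x) => u v k w r s; ring.
have xR : inner_corner K phi = al phi *: uvec phi + ga phi *: vvec phi.
  rewrite corner; last by lra.
  by apply: injective_projections; rewrite /= /GRing.scale /=; ring.
have xL : inner_corner K L = refl (ga L *: uvec phi + al L *: vvec phi).
  rewrite corner /L; last by lra.
  rewrite cos_pihalfB sin_pihalfB -/L.
  by apply: injective_projections; rewrite /= /GRing.scale /=; ring.
rewrite /calQ -/L xR xL qx; rewrite -/L in qD.
move: qK qB qD.
move: (area K) (boundary_arc_area _ _ _) (boundary_arc_area _ _ _) (segment_area _ _) (segment_area _ _).
move=> kk r1 r2 r3 r4.
move: (tan phi) (al phi) (ga phi) (al L) (ga L) (_ / cos phi) (_ / cos phi)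
  => u1 u2 u3 u4 u5 u6 u7.
move=> qK qB qD.
lra.
Qed.

End functional.

(** * Concavity *)

Section quadratic.
Context {R : realType}.
Implicit Types (l x : R) (f g N F : R -> R).

(** A square is affine along a segment up to [l * (1 - l)] times the square of
    the difference of the end points. *)
Lemma antiderivative_comb l N1 N2 N3 (u v w : R -> R) :
  (forall x, is_derive x 1 N1 (u x)) -> (forall x, is_derive x 1 N2 (v x)) ->
  (forall x, is_derive x 1 N3 (w x)) -> forall x,
  is_derive x 1 (fun x => (1 - l) * N1 x + l * N2 x + - (l * (1 - l) * N3 x))
    ((1 - l) * u x + l * v x - l * (1 - l) * w x).
Proof.
move=> H1 H2 H3 x.
apply: is_derive_eq (derive_add (derive_add (derive_mul (derive_cst (1 - l) x) (H1 x))
  (derive_mul (derive_cst l x) (H2 x))) (derive_opp (derive_mul (derive_cst (l * (1 - l)) x) (H3 x)))) _.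
by ring.
Qed.

Lemma profile_antiderivative (B : set (plane R)) phi : grounded B ->
  exists M : R -> R, forall y : R, is_derive y 1 M (profile B phi (Num.max 0 y)).
Proof. by move=> gB; apply: antiderivative_exists; exact: profile_max_continuous. Qed.

End quadratic.

Theorem theorem8p3p8 (R : realType) (p q phi theta : R)
    (hphi : gerver_constants p q phi theta)
    (K1 B1 D1 K2 B2 D2 : set (plane R))
    (h1 : calL phi (K1, B1, D1)) (h2 : calL phi (K2, B2, D2))
    (lambda : R) (hlambda : 0 <= lambda <= 1) :
  (1 - lambda) * calQ phi (K1, B1, D1) + lambda * calQ phi (K2, B2, D2)
  <= calQ phi (triple_comb lambda (K1, B1, D1) (K2, B2, D2)).
Proof.
have phir : 0 < phi < pi / 4.
  by have [ph0 [pt t4]] := gerver_range hphi; rewrite ph0 (lt_trans pt).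
have /andP[phi0 phi4] := phir; have /andP[l0 l1] := hlambda.
have pi0 : 0 < pi :> R := pi_gt0 R.
have c0 : 0 < cos phi by apply: cos_gt0_pihalf; lra.
have [a1 [da1 [g1 [dg1 d1]]]] := data_exists phir h1.
have [a2 [da2 [g2 [dg2 d2]]]] := data_exists phir h2.
have dl := data_combination hlambda d1 d2.
have [gB1 [gD1 [v1 Q1]]] := calQ_formula phir d1.
have [gB2 [gD2 [v2 Q2]]] := calQ_formula phir d2.
have [gBl [gDl [vl Ql]]] := calQ_formula phir dl.
have ca1 := derive_continuous (data_dal d1); have cg1 := derive_continuous (data_dga d1).
have ca2 := derive_continuous (data_dal d2); have cg2 := derive_continuous (data_dga d2).
have cda1 := data_cal d1; have cdg1 := data_cga d1.
have cda2 := data_cal d2; have cdg2 := data_cga d2.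
(* antiderivatives of the quadratic densities, for any frame functions *)
have anti (a da c dc : R -> R) : continuous a -> continuous da -> continuous c -> continuous dc ->
  exists Na Nc M : R -> R, [/\ forall x : R, is_derive x 1 Na (a x ^+ 2 - da x ^+ 2),
    forall x : R, is_derive x 1 Nc (c x ^+ 2 - dc x ^+ 2) &
    forall x : R, is_derive x 1 M (a x ^+ 2 + c x ^+ 2 + a x * dc x - c x * da x)].
  move=> ca cda cc cdc.
  have sq (f df : R -> R) : continuous f -> continuous df ->
      exists N : R -> R, forall x : R, is_derive x 1 N (f x ^+ 2 - df x ^+ 2).
    move=> cf cdf; apply: antiderivative_exists.
    by apply: continuous_add; [|apply: continuous_opp]; apply: continuous_mul.
  have [Na HNa] := sq _ _ ca cda; have [Nc HNc] := sq _ _ cc cdc.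
  have [M HM] : exists M : R -> R, forall x : R, is_derive x 1 M (a x ^+ 2 + c x ^+ 2 + a x * dc x - c x * da x).
    apply: antiderivative_exists; apply: continuous_add; last first.
      by apply: continuous_opp; exact: continuous_mul.
    apply: continuous_add; last exact: continuous_mul.
    by apply: continuous_add; exact: continuous_mul.
  by exists Na, Nc, M.
have one (f : R -> R) : continuous f -> continuous (fun x => f x + 1).
  by move=> cf; apply: continuous_add => // x; exact: cvg_cst.
have [Nh1 [Nk1 [_ [HNh1 HNk1 _]]]] := anti _ _ _ _ (one _ ca1) cda1 (one _ cg1) cdg1.
have [Nh2 [Nk2 [_ [HNh2 HNk2 _]]]] := anti _ _ _ _ (one _ ca2) cda2 (one _ cg2) cdg2.
have [_ [_ [M1 [_ _ HM1]]]] := anti _ _ _ _ ca1 cda1 cg1 cdg1.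
have [_ [_ [M2 [_ _ HM2]]]] := anti _ _ _ _ ca2 cda2 cg2 cdg2.
pose a x := a1 x - a2 x; pose da x := da1 x - da2 x.
pose c x := g1 x - g2 x; pose dc x := dg1 x - dg2 x.
have sub (f g : R -> R) : continuous f -> continuous g -> continuous (fun x => f x - g x).
  by move=> cf cg; apply: continuous_add => //; exact: continuous_opp.
have [Na [Nc [M [HNa HNc HM]]]] := anti a da c dc (sub _ _ ca1 ca2) (sub _ _ cda1 cda2)
  (sub _ _ cg1 cg2) (sub _ _ cdg1 cdg2).
have [Mb1 HMb1] := profile_antiderivative phi gB1.
have [Mb2 HMb2] := profile_antiderivative phi gB2.
have [Mbl HMbl] := profile_antiderivative phi gBl.
have [Md1 HMd1] := profile_antiderivative phi gD1.
have [Md2 HMd2] := profile_antiderivative phi gD2.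
have [Mdl HMdl] := profile_antiderivative phi gDl.
pose T := Num.max 0 (Num.max v1 (Num.max v2 vl)).
have T0 : 0 <= T by rewrite le_max lexx.
have T1 : v1 <= T by rewrite /T !le_max lexx !orbT.
have T2 : v2 <= T by rewrite /T !le_max lexx !orbT.
have Tl : vl <= T by rewrite /T !le_max lexx !orbT.
have {}Q1 := Q1 _ _ _ _ _ _ HNh1 HNk1 HM1 HMb1 HMd1 T1.
have {}Q2 := Q2 _ _ _ _ _ _ HNh2 HNk2 HM2 HMb2 HMd2 T2.
have HNhl := antiderivative_comb lambda HNh1 HNh2 HNa.
have HNkl := antiderivative_comb lambda HNk1 HNk2 HNc.
have HMl := antiderivative_comb lambda HM1 HM2 HM.
have {HNhl}HNhl (x : R) : is_derive x 1 (fun x => (1 - lambda) * Nh1 x + lambda * Nh2 x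
    + - (lambda * (1 - lambda) * Na x))
    (((1 - lambda) * a1 x + lambda * a2 x + 1) ^+ 2 - ((1 - lambda) * da1 x + lambda * da2 x) ^+ 2).
  by apply: is_derive_eq (HNhl x) _; rewrite /a /da; ring.
have {HNkl}HNkl (x : R) : is_derive x 1 (fun x => (1 - lambda) * Nk1 x + lambda * Nk2 x
    + - (lambda * (1 - lambda) * Nc x))
    (((1 - lambda) * g1 x + lambda * g2 x + 1) ^+ 2 - ((1 - lambda) * dg1 x + lambda * dg2 x) ^+ 2).
  by apply: is_derive_eq (HNkl x) _; rewrite /c /dc; ring.
have {HMl}HMl (x : R) : is_derive x 1 (fun x => (1 - lambda) * M1 x + lambda * M2 x
    + - (lambda * (1 - lambda) * M x))
    (((1 - lambda) * a1 x + lambda * a2 x) ^+ 2 + ((1 - lambda) * g1 x + lambda * g2 x) ^+ 2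
     + ((1 - lambda) * a1 x + lambda * a2 x) * ((1 - lambda) * dg1 x + lambda * dg2 x)
     - ((1 - lambda) * g1 x + lambda * g2 x) * ((1 - lambda) * da1 x + lambda * da2 x)).
  by apply: is_derive_eq (HMl x) _; rewrite /a /da /c /dc; ring.
have {}Ql := Ql _ _ _ _ _ _ HNhl HNkl HMl HMbl HMdl Tl.
have aT : a (pi / 2) = 0.
  have p2 : 0 <= (pi / 2 : R) <= (pi / 2 : R) by rewrite lexx ?andbT /= divr_ge0// ltW.
  by rewrite /a -(data_al d1 p2) -(data_al d2 p2) (data_top d1) (data_top d2) subrr.
have cT : c 0 = 0.
  have p2 : 0 <= (0 : R) <= (pi / 2 : R) by rewrite lexx ?andbT /= divr_ge0// ltW.
  by rewrite /c -(data_ga d1 p2) -(data_ga d2 p2) add0r (data_top d1) (data_top d2) subrr.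
have dsub (f df g dg : R -> R) : (forall x : R, is_derive x 1 f (df x)) ->
    (forall x : R, is_derive x 1 g (dg x)) -> forall x : R, is_derive x 1 (fun x => f x - g x) (df x - dg x).
  by move=> Hf Hg x; exact: derive_add (Hf x) (derive_opp (Hg x)).
have form := defect_form_le0 phir erefl (dsub _ _ _ _ (data_dal d1) (data_dal d2))
  (dsub _ _ _ _ (data_dga d1) (data_dga d2)) HNa HNc HM aT cT.
have EB := profile_antiderivative_convex hlambda T0 gB1 gB2 HMb1 HMb2 HMbl.
have ED : Mdl T - Mdl 0 <= (1 - lambda) * (Md1 T - Md1 0) + lambda * (Md2 T - Md2 0).
  apply: (profile_antiderivative_convex hlambda T0 gD1 gD2 HMd1 HMd2) => y.
  by rewrite minkowski_refl; exact: HMdl.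
have ic : 0 < (cos phi)^-1 by rewrite invr_gt0.
have ll : 0 <= lambda * (1 - lambda) by rewrite mulr_ge0// subr_ge0.
rewrite -subr_ge0 -(pmulr_rge0 _ (ltr0n R 2)).
have -> : 2 * (calQ phi (triple_comb lambda (K1, B1, D1) (K2, B2, D2)) -
     ((1 - lambda) * calQ phi (K1, B1, D1) + lambda * calQ phi (K2, B2, D2))) =
  2 * calQ phi (minkowski_comb lambda K1 K2, minkowski_comb lambda B1 B2, minkowski_comb lambda D1 D2)
  - ((1 - lambda) * (2 * calQ phi (K1, B1, D1)) + lambda * (2 * calQ phi (K2, B2, D2))).
  rewrite [triple_comb _ _ _]/triple_comb.
  by move: (calQ _ _) (calQ _ _) (calQ _ _) => u v w; ring.
rewrite Ql Q1 Q2.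
move: form; rewrite /a /c; move: EB ED ll.
move: (Mbl T) (Mbl 0) (Mb1 T) (Mb1 0) (Mb2 T) (Mb2 0) => x1 x2 x3 x4 x5 x6 EB.
move: (Mdl T) (Mdl 0) (Md1 T) (Md1 0) (Md2 T) (Md2 0) => z1 z2 z3 z4 z5 z6 ED.
move: (pi / 2 - phi) => L ll form.
have BB : 0 <= 2 * (((1 - lambda) * (x3 - x4) + lambda * (x5 - x6) - (x1 - x2)) / cos phi).
  by rewrite mulr_ge0// mulr_ge0 ?subr_ge0// ltW.
have DD : 0 <= 2 * (((1 - lambda) * (z3 - z4) + lambda * (z5 - z6) - (z1 - z2)) / cos phi).
  by rewrite mulr_ge0// mulr_ge0 ?subr_ge0// ltW.
rewrite -oppr_ge0 in form.
have := addr_ge0 (addr_ge0 (mulr_ge0 ll form) BB) DD.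
congr (0 <= _).
move: (tan phi) (cos phi)^-1 (a1 phi) (a2 phi) (a1 L) (a2 L) (g1 phi) (g2 phi) (g1 L) (g2 L).
move=> t ci b1 b2 b3 b4 b5 b6 b7 b8.
ring.
Qed.
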